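(* Let $(X,\|\cdot\|_X)$ and $(Y,\|\cdot\|_Y)$ be two-dimensional real normed spaces for which there exists an onto isometry $\tau:S_X\to S_Y$ between their unit spheres. If there is some nonempty relatively open subset $U\subset S_X$ on which $\tau$ is linear, then $\tau$ is linear on $S_X$.
   Context: $S_X$ and $S_Y$ denote the unit spheres, with the distances $\|x-x'\|_X$ and $\|y-y'\|_Y$ respectively; an onto isometry is a surjective distance-preserving map. For a subset $A\subset S_X$, ''$\tau$ is linear on $A$'' means that there is a linear map $T:X\to Y$ with $\tau(x)=T(x)$ for every $x\in A$. *)

(* Defs.v *)
From HB Require Import structures.
From mathcomp Require Import all_boot all_order all_algebra.
From mathcomp Require Import all_classical reals topology normedtype.

Set Implicit Arguments.
Unset Strict Implicit.
Unset Printing Implicit Defensive.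

Import Order.TTheory GRing.Theory Num.Theory.
Import numFieldNormedType.Exports.

Local Open Scope classical_set_scope.
Local Open Scope ring_scope.

(* The norm is that of the normed module; the vector-space structure only
   provides the finite dimension \dim {: V}. *)
#[short(type="normedVectType")]
HB.structure Definition NormedVector (R : numFieldType) :=
  {V of NormedModule R V & Vector R V}.

Definition unit_sphere (R : numFieldType) (V : normedModType R) : set V :=
  [set x | `|x| = 1].
Arguments unit_sphere {R} V.

Definition onto_isometry (R : numFieldType) (V W : normedModType R)
    (A : set V) (B : set W) (f : V -> W) : Prop :=
  [/\ set_fun A B f,
      forall x x', A x -> A x' -> `|f x - f x'| = `|x - x'| &
      set_surj A B f].

Definition linear_on (R : numFieldType) (V W : normedModType R)
    (A : set V) (f : V -> W) : Prop :=
  exists T : {linear V -> W}, forall x, A x -> f x = T x.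

(* Members of a relatively open set are required to lie in A: in the library,
   openness in [subspace A] puts no constraint on points outside A. *)
Definition relatively_open (T : topologicalType) (A U : set T) : Prop :=
  U `<=` A /\ open (U : set (subspace A)).

(* Main.v *)
(** Pull both norms back to the plane along the given linear map; then the unit
spheres share an arc that the isometry fixes pointwise, together with its
opposite arc, and it remains to continue this arc past its end point [p].

If no segment of the sphere ends at [p] along the arc: for [x] just beyond [p],
with image [y], and [q] on the fixed arc, the sums [x + q] and [y + q] have the
same norm and lie over the fixed arc, where both norms agree.  If [x <> y], two
choices of [q] give two parallel chords of the sphere, which by convexity lie on
one line; this produces a segment ending at [p].

If the arc ends with a face [[q, p]], choose coordinates with [p = (1, 1)] and
[q = (-1, 1)].  For [x = (u, w)], the least norm of a sum of [x] with a point of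
the face is [1 + w] as long as [u <= 2 + w], so that the isometry preserves the
heights of such points.  A point of the right arc on the line [u = 2 + w] (or at
height [0], if there is none above) is fixed; comparing the distances to the
points of the face, all points of the right arc above it are fixed too. *)

Require Import Defs.
From HB Require Import structures.
From mathcomp Require Import all_boot all_order all_algebra.
From mathcomp Require Import all_classical reals topology normedtype derive.
From mathcomp Require Import ring lra.

Set Implicit Arguments.
Unset Strict Implicit.
Unset Printing Implicit Defensive.

Import Order.TTheory GRing.Theory Num.Theory.
Import numFieldNormedType.Exports.

Local Open Scope classical_set_scope.
Local Open Scope ring_scope.

(** * Norms on the plane *)

(** An isometry of spheres controls only differences, so a sum [x + q] is accessible only when [- q]
    is a fixed point. The hypothesis on [U] says nothing about antipodes, so the opposite arc has to
    be obtained separately. For [x] in the arc let [- z] be the image of [- x]. It is at distance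
    [2] from [x], so [x + z] has norm [2], and if [z] differs from [x] the second sphere contains
    the segment from [x] to [z]. Both norms agree over the arc, hence the first sphere has a segment
    over it too. Over such a segment the opposite face could still be reflected; following one more
    point of the sphere excludes this. A subarc with fixed antipodes is enough, because the
    continuation carries both signs of every direction.

    The continuation itself is a supremum argument on the slopes [t] of the directions [(t, 1)]:
    fixed directions are closed under limits, and each end point only has to be passed by a small
    amount. *)

Definition planar_norm (R : realType) (N : R -> R -> R) : Prop :=
  [/\ forall a b c d, N (a + c) (b + d) <= N a b + N c d,
      forall k a b, N (k * a) (k * b) = `|k| * N a b &
      forall a b, N a b = 0 -> a = 0 /\ b = 0].

Section PlanarNorm.
Context {R : realType} (N : R -> R -> R) (hN : planar_norm N).
Implicit Types (a b c d k l s t u v w x y : R).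

Lemma norm_triangle a b c d : N (a + c) (b + d) <= N a b + N c d.
Proof. by have [h _ _] := hN. Qed.

Lemma norm_scale k a b : N (k * a) (k * b) = `|k| * N a b.
Proof. by have [_ h _] := hN. Qed.

Lemma norm_eq0 a b : N a b = 0 -> a = 0 /\ b = 0.
Proof. by have [_ _ h] := hN; apply: h. Qed.

Lemma norm_scale_ge0 k a b : 0 <= k -> N (k * a) (k * b) = k * N a b.
Proof. by move=> k0; rewrite norm_scale ger0_norm. Qed.

Lemma norm00 : N 0 0 = 0.
Proof. by have := norm_scale 0 0 0; rewrite normr0 !mul0r. Qed.

Lemma normN a b : N (- a) (- b) = N a b.
Proof. by rewrite -mulN1r -(mulN1r b) norm_scale normrN normr1 mul1r. Qed.

Lemma norm_ge0 a b : 0 <= N a b.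
Proof.
have := norm_triangle a b (- a) (- b); rewrite !subrr norm00 normN => h; lra.
Qed.

Lemma norm_gt0 a b : 0 < b -> 0 < N a b.
Proof.
move=> b0; rewrite lt_neqAle norm_ge0 andbT eq_sym; apply/eqP => h.
by have [_ b0'] := norm_eq0 h; rewrite b0' ltxx in b0.
Qed.

Lemma norm_comb a b c d k l : 0 <= k -> 0 <= l ->
  N (k * a + l * c) (k * b + l * d) <= k * N a b + l * N c d.
Proof.
move=> k0 l0; rewrite -(norm_scale_ge0 a b k0) -(norm_scale_ge0 c d l0).
exact: norm_triangle.
Qed.

Lemma norm_comb_eq a b c d k l x y : 0 <= k -> 0 <= l ->
  x = k * a + l * c -> y = k * b + l * d -> N x y <= k * N a b + l * N c d.
Proof. by move=> k0 l0 -> ->; exact: norm_comb. Qed.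

Lemma norm_lip a b c d : N a b <= N c d + N (a - c) (b - d).
Proof.
have -> : N a b = N (c + (a - c)) (d + (b - d)) by congr N; ring.
exact: norm_triangle.
Qed.

Lemma norm_sub_sym a b c d : N (a - c) (b - d) = N (c - a) (d - b).
Proof. by rewrite -normN; congr N; ring. Qed.

Lemma norm_hor s : N s 0 = `|s| * N 1 0.
Proof. by rewrite -norm_scale; congr N; ring. Qed.

Lemma norm_vert s : N 0 s = `|s| * N 0 1.
Proof. by rewrite -norm_scale; congr N; ring. Qed.

Lemma norm_le_coord a b : N a b <= `|a| * N 1 0 + `|b| * N 0 1.
Proof.
rewrite -(norm_hor a) -(norm_vert b).
have -> : N a b = N (a + 0) (0 + b) by congr N; ring.
exact: norm_triangle.
Qed.

Lemma norm10_gt0 : 0 < N 1 0.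
Proof.
rewrite lt_neqAle norm_ge0 andbT eq_sym; apply/eqP => /norm_eq0[/eqP].
by rewrite oner_eq0.
Qed.

Lemma norm_mono z s s' w : z <= s -> s <= s' -> N z w <= N s' w ->
  N s w <= N s' w.
Proof.
move=> zs ss' h; have [e|ne] := eqVneq z s'.
  by rewrite (_ : s = s')//; lra.
have zs' : 0 < s' - z by rewrite subr_gt0 lt_neqAle ne /=; lra.
have := @norm_comb_eq z w s' w (s' - s) (s - z) ((s' - z) * s) ((s' - z) * w).
rewrite norm_scale_ge0 ?(ltW zs')// => h1.
have {}h1 := h1 ltac:(lra) ltac:(lra) ltac:(ring) ltac:(ring).
have h2 : 0 <= (s' - s) * (N s' w - N z w) by rewrite mulr_ge0// subr_ge0.
rewrite -(ler_pM2l zs'); lra.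
Qed.

Lemma norm_mono_lt z s s' w : z <= s -> s < s' -> N z w < N s' w ->
  N s w < N s' w.
Proof.
move=> zs ss' h.
have zs' : 0 < s' - z by lra.
have := @norm_comb_eq z w s' w (s' - s) (s - z) ((s' - z) * s) ((s' - z) * w).
rewrite norm_scale_ge0 ?(ltW zs')// => h1.
have {}h1 := h1 ltac:(lra) ltac:(lra) ltac:(ring) ltac:(ring).
have h2 : 0 < (s' - s) * (N s' w - N z w) by rewrite mulr_gt0// subr_gt0.
rewrite -(ltr_pM2l zs'); lra.
Qed.

(** Equality in a single triangle inequality propagates to the whole cone: some multiple [t] of the
    given combination dominates any other one, and a deficit of the latter would persist after
    adding the complementary combination. *)
Lemma norm_linear_on a b c d k l : 0 < k -> 0 < l ->
  N (k * a + l * c) (k * b + l * d) = k * N a b + l * N c d ->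
  forall k' l', 0 <= k' -> 0 <= l' ->
  N (k' * a + l' * c) (k' * b + l' * d) = k' * N a b + l' * N c d.
Proof.
move=> k0 l0 e k' l' k'0 l'0; apply/eqP; rewrite eq_le norm_comb//=.
pose t := k' / k + l' / l.
have tk : k' <= t * k.
  by rewrite /t mulrDl divfK ?gt_eqF// lerDl !mulr_ge0 ?invr_ge0// ltW.
have tl : l' <= t * l.
  by rewrite /t mulrDl divfK ?gt_eqF// lerDr !mulr_ge0 ?invr_ge0// ltW.
have t0 : 0 <= t by rewrite addr_ge0// divr_ge0// ltW.
have h1 := norm_triangle (k' * a + l' * c) (k' * b + l' * d)
  ((t * k - k') * a + (t * l - l') * c) ((t * k - k') * b + (t * l - l') * d).
have := @norm_comb a b c d (t * k - k') (t * l - l') ltac:(lra) ltac:(lra).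
move: h1.
have -> : N (k' * a + l' * c + ((t * k - k') * a + (t * l - l') * c))
  (k' * b + l' * d + ((t * k - k') * b + (t * l - l') * d)) =
  t * (k * N a b + l * N c d).
  by rewrite -e -norm_scale_ge0//; congr N; ring.
move=> h1 h2; lra.
Qed.

Lemma continuous_norm_hor : continuous (fun s => N s 1).
Proof.
move=> s; apply/cvgrPdist_le => e e0.
have c0 := norm10_gt0.
have d0 : 0 < e / N 1 0 by rewrite divr_gt0.
near=> t.
have h1 := norm_lip s 1 t 1; have h2 := norm_lip t 1 s 1.
move: h1 h2; rewrite subrr (norm_hor (s - t)) (norm_hor (t - s)) => h1 h2.
have : `|s - t| <= e / N 1 0.
  by near: t; apply: cvgr_dist_le.
rewrite ler_pdivlMr// => h3; rewrite ler_norml; rewrite (distrC t s) in h2.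
apply/andP; split; lra.
Unshelve. all: by end_near.
Qed.

Lemma norm_ge_vert : exists2 m, 0 < m & forall a b, m * `|b| <= N a b.
Proof.
have c0 := norm10_gt0.
(* Beyond [M] the horizontal part alone gives [N s 1 >= 1]; on the compact interval the minimum is
   attained. *)
pose M := (N 0 1 + 1) / N 1 0.
have M0 : 0 <= M by rewrite divr_ge0 ?norm_ge0// addr_ge0// norm_ge0.
have [x _ hx] := @EVT_min R (fun s => N s 1) (- M) M ltac:(lra)
  (continuous_subspaceT continuous_norm_hor).
have fx0 : 0 < N x 1 by apply: norm_gt0.
pose m := Num.min (N x 1) 1.
have hm s : m <= N s 1.
  have [sM|sM] := leP `|s| M.
    apply: (@le_trans _ _ (N x 1)); first by rewrite /m ge_min lexx.
    by apply: hx; rewrite in_itv/= -ler_norml.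
  apply: (@le_trans _ _ 1); first by rewrite /m ge_min lexx orbT.
  have := norm_lip s 0 s 1; rewrite subrr sub0r -(normN 0) oppr0 opprK (norm_hor s).
  have : N 0 1 + 1 <= `|s| * N 1 0 by rewrite -ler_pdivrMr// ltW.
  move=> h1 h2; lra.
exists m; first by rewrite /m lt_min fx0 ltr01.
move=> a b; have [->|b0] := eqVneq b 0.
  by rewrite normr0 mulr0 norm_ge0.
have -> : N a b = `|b| * N (a / b) 1.
  by rewrite -norm_scale; congr N; field.
by rewrite mulrC ler_pM2l ?normr_gt0.
Qed.

Lemma norm_ge_coord : exists2 m, 0 < m &
  forall a b, m * `|a| <= N a b /\ m * `|b| <= N a b.
Proof.
have [m m0 hm] := norm_ge_vert; have c0 := norm10_gt0.
have n0 := norm_ge0 0 1.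
have K0 : 0 < m + N 0 1 by lra.
pose m' := m * N 1 0 / (m + N 0 1).
have m'0 : 0 < m' by rewrite divr_gt0// mulr_gt0.
have ha a b : m' * `|a| <= N a b.
  have := norm_lip a 0 a b; rewrite subrr sub0r -(normN 0) oppr0 opprK.
  rewrite (norm_hor a) (norm_vert b) => h; have h2 := hm a b.
  rewrite /m' mulrAC ler_pdivrMr//.
  have h3 : m * (`|a| * N 1 0) <= m * (N a b + `|b| * N 0 1) by rewrite ler_pM2l.
  have h4 : m * `|b| * N 0 1 <= N a b * N 0 1 by rewrite ler_wpM2r.
  lra.
exists (Num.min m m'); first by rewrite lt_min m0.
move=> a b; split.
  by apply: le_trans (ha a b); rewrite ler_wpM2r// ge_min lexx orbT.
by apply: le_trans (hm a b); rewrite ler_wpM2r// ge_min lexx.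
Qed.

End PlanarNorm.

(** The witness is the supremum of the points with [f x <= 1]. The last crossing is taken so that
    everything beyond it lies outside the ball, as the end of a face requires. *)
Lemma last_crossing (R : realType) (f : R -> R) (K a b : R) :
  (forall x y, f x <= f y + K * `|x - y|) -> a <= b -> f a <= 1 -> 1 < f b ->
  exists w, [/\ a <= w, w < b, f w = 1 & forall x, w < x -> x <= b -> 1 < f x].
Proof.
move=> lip ab fa fb.
pose K' := Num.max K 1.
have K'0 : 0 < K' by rewrite lt_max ltr01 orbT.
have {}lip x y : f x <= f y + K' * `|x - y|.
  apply: le_trans (lip x y) _; rewrite lerD2l ler_wpM2r//.
  by rewrite le_max lexx.
pose S := [set x | a <= x <= b /\ f x <= 1].
have Sa : S a by split=> //; rewrite lexx.
have hS : has_sup S.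
  by split; [exists a|exists b => x [/andP[]]].
pose w := sup S.
have aw : a <= w by apply: ub_le_sup => //; case: hS.
have wb : w <= b by apply: ge_sup; [exists a|move=> x [/andP[]]].
have fw1 : f w <= 1.
  rewrite leNgt; apply/negP => fw.
  have e0 : 0 < (f w - 1) / K' by rewrite divr_gt0// subr_gt0.
  have [x [/andP[ax xb] fx] xw] := sup_adherent e0 hS.
  have xw' : x <= w by apply: ub_le_sup; [case: hS|split; rewrite ?ax].
  have := lip w x; rewrite ger0_norm ?subr_ge0//.
  have : K' * (w - x) < f w - 1.
    by rewrite mulrC -ltr_pdivlMr//; rewrite -/w in xw; lra.
  lra.
have after x : w < x -> x <= b -> 1 < f x.
  move=> wx xb; rewrite ltNge; apply/negP => fx.
  suff : x <= w by rewrite leNgt wx.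
  apply: ub_le_sup; first by case: hS.
  by split=> //; rewrite xb andbT; lra.
have wb' : w < b.
  by rewrite lt_neqAle wb andbT; apply/eqP => e; rewrite e in fw1; lra.
exists w; split=> //; apply/eqP; rewrite eq_le fw1 leNgt /=; apply/negP => fw.
pose d := Num.min ((1 - f w) / K') (b - w).
have d0 : 0 < d by rewrite lt_min !subr_gt0 wb' andbT divr_gt0// subr_gt0.
have dK : K' * d <= 1 - f w.
  by rewrite mulrC -ler_pdivlMr// /d ge_min lexx.
have db : d <= b - w by rewrite /d ge_min lexx orbT.
have := after (w + d) ltac:(lra) ltac:(lra).
have := lip (w + d) w; rewrite (_ : w + d - w = d); last by ring.
by rewrite (gtr0_norm d0); lra.
Qed.

(** A relation between coordinates, so that the inverse isometry and the conjugates by negation,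
    reflection or a change of basis are obtained by rewriting arguments. For planar norms the
    distance condition makes it single-valued. *)
Definition planar_isom (R : realType) (N1 N2 : R -> R -> R)
    (J : R -> R -> R -> R -> Prop) : Prop :=
  [/\ forall a b c d, J a b c d -> N1 a b = 1 /\ N2 c d = 1,
      forall a b, N1 a b = 1 -> exists c d, J a b c d,
      forall c d, N2 c d = 1 -> exists a b, J a b c d &
      forall a b c d a' b' c' d', J a b c d -> J a' b' c' d' ->
        N1 (a - a') (b - b') = N2 (c - c') (d - d')].

Lemma planar_isom_sym (R : realType) (N1 N2 : R -> R -> R) J :
  planar_isom N1 N2 J -> planar_isom N2 N1 (fun a b c d => J c d a b).
Proof.
move=> [h1 h2 h3 h4]; split=> //.
- by move=> a b c d /h1[].
- by move=> a b c d a' b' c' d' h h'; rewrite (h4 _ _ _ _ _ _ _ _ h h').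
Qed.

Lemma planar_isom_neg (R : realType) (N1 N2 : R -> R -> R) J :
  planar_norm N1 -> planar_norm N2 -> planar_isom N1 N2 J ->
  planar_isom N1 N2 (fun a b c d => J (- a) (- b) (- c) (- d)).
Proof.
move=> n1 n2 [h1 h2 h3 h4]; split=> //.
- by move=> a b c d /h1; rewrite !normN.
- move=> a b; rewrite -(normN n1) => /h2[c [d h]].
  by exists (- c), (- d); rewrite !opprK.
- move=> c d; rewrite -(normN n2) => /h3[a [b h]].
  by exists (- a), (- b); rewrite !opprK.
- move=> a b c d a' b' c' d' h h'; have := h4 _ _ _ _ _ _ _ _ h h'.
  rewrite !opprK => e; rewrite -(normN n1) -(normN n2).
  by rewrite !opprD !opprK.
Qed.

Lemma planar_norm_basis (R : realType) (N : R -> R -> R) (p1 p2 q1 q2 : R) :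
  p1 * q2 - p2 * q1 != 0 -> planar_norm N ->
  planar_norm (fun a b => N (a * p1 + b * q1) (a * p2 + b * q2)).
Proof.
move=> det hN; split.
- move=> a b c d /=.
  have -> : N ((a + c) * p1 + (b + d) * q1) ((a + c) * p2 + (b + d) * q2) =
      N (a * p1 + b * q1 + (c * p1 + d * q1))
        (a * p2 + b * q2 + (c * p2 + d * q2)) by congr N; ring.
  exact: norm_triangle.
- by move=> k a b /=; rewrite -(norm_scale hN); congr N; ring.
- move=> a b /(norm_eq0 hN)[e1 e2]; split; apply: (mulIf det); rewrite mul0r.
  + transitivity (q2 * (a * p1 + b * q1) - q1 * (a * p2 + b * q2)).
      by ring.
    by rewrite e1 e2; ring.
  + transitivity (p1 * (a * p2 + b * q2) - p2 * (a * p1 + b * q1)).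
      by ring.
    by rewrite e1 e2; ring.
Qed.

Lemma planar_isom_basis (R : realType) (N1 N2 : R -> R -> R) J
    (p1 p2 q1 q2 : R) :
  p1 * q2 - p2 * q1 != 0 -> planar_isom N1 N2 J ->
  planar_isom (fun a b => N1 (a * p1 + b * q1) (a * p2 + b * q2))
    (fun a b => N2 (a * p1 + b * q1) (a * p2 + b * q2))
    (fun a b c d => J (a * p1 + b * q1) (a * p2 + b * q2)
                      (c * p1 + d * q1) (c * p2 + d * q2)).
Proof.
move=> det [h1 h2 h3 h4].
have solve x y : exists a b, x = a * p1 + b * q1 /\ y = a * p2 + b * q2.
  exists ((x * q2 - y * q1) / (p1 * q2 - p2 * q1)),
    ((p1 * y - p2 * x) / (p1 * q2 - p2 * q1)).
  by split; field.
split=> //.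
- by move=> a b c d /h1.
- move=> a b /h2[x [y h]]; have [c [d [e1 e2]]] := solve x y.
  by exists c, d; rewrite -e1 -e2.
- move=> a b /h3[x [y h]]; have [c [d [e1 e2]]] := solve x y.
  by exists c, d; rewrite -e1 -e2.
- move=> a b c d a' b' c' d' h h'; have e := h4 _ _ _ _ _ _ _ _ h h'.
  transitivity (N1 (a * p1 + b * q1 - (a' * p1 + b' * q1))
    (a * p2 + b * q2 - (a' * p2 + b' * q2))); first by congr N1; ring.
  by rewrite e; congr N2; ring.
Qed.

(* Both signs of [l] are included: antipodal points are fixed together. *)
Definition fixed_dir (R : realType) (N : R -> R -> R)
    (J : R -> R -> R -> R -> Prop) (a b : R) : Prop :=
  forall l, N (l * a) (l * b) = 1 -> J (l * a) (l * b) (l * a) (l * b).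

(** * Norms whose unit sphere contains a horizontal face *)

Section FlatNorm.
Context {R : realType} (N : R -> R -> R) (hN : planar_norm N).
Hypothesis flatN : forall s, -1 <= s -> s <= 1 -> N s 1 = 1.
Implicit Types (r s u w : R).

Lemma flat_in s w : - w <= s -> s <= w -> N s w = w.
Proof.
move=> sw ws; have [w0|w0] := eqVneq w 0.
  have -> : s = 0 by lra.
  by rewrite w0 (norm00 hN).
have wp : 0 < w by rewrite lt_neqAle eq_sym w0 /=; lra.
have -> : N s w = N (w * (s / w)) (w * 1) by congr N; field.
rewrite (norm_scale_ge0 hN) 1?ltW// flatN ?mulr1//.
  by rewrite ler_pdivlMr//; lra.
by rewrite ler_pdivrMr//; lra.
Qed.

Lemma flat_norm0 w : N 0 w = `|w|.
Proof. by rewrite (norm_vert hN) flatN ?mulr1//; lra. Qed.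

(** The line of the face supports the ball: adding [k] times a face point leaning the other way
    brings [(r, 1)] to the vertical axis, where the norm is the height. *)
Lemma flat_ge_norm s w : `|w| <= N s w.
Proof.
have ge1 r : 1 <= N r 1.
  pose k := `|r| + 1.
  have k0 : 0 < k by rewrite ltr_wpDl.
  have rk : - k <= r /\ r <= k.
    by have := ler_norm r; have := ler_norm (- r); rewrite normrN /k; lra.
  have := @norm_comb_eq _ _ hN r 1 (- r / k) 1 1 k 0 (1 + k) ler01 (ltW k0).
  have -> : N (- r / k) 1 = 1.
    by apply: flatN; rewrite ?ler_pdivlMr ?ler_pdivrMr//; lra.
  rewrite flat_norm0 (@ger0_norm _ (1 + k)); last by lra.
  by move=> /(_ _ _)h; have := h ltac:(by field; lra) ltac:(ring); lra.
have [->|w0] := eqVneq w 0; first by rewrite normr0 norm_ge0.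
have -> : N s w = N (w * (s / w)) (w * 1) by congr N; field.
by rewrite (norm_scale hN) ler_peMr.
Qed.

Lemma flat_ge s w : w <= N s w.
Proof. by apply: le_trans (flat_ge_norm s w); exact: ler_norm. Qed.

Lemma flat_mono s s' w : 0 <= s -> s <= s' -> N s w <= N s' w.
Proof.
by move=> s0 ss'; apply: (norm_mono hN s0 ss'); rewrite flat_norm0 flat_ge_norm.
Qed.

Lemma flat_mono_lt s s' w : 0 <= s -> s < s' -> `|w| < N s' w ->
  N s w < N s' w.
Proof.
by move=> s0 ss' h; apply: (norm_mono_lt hN s0 ss'); rewrite flat_norm0.
Qed.

Lemma flat_monoN s s' w : s <= s' -> s' <= 0 -> N s' w <= N s w.
Proof.
by move=> ss' s'0; rewrite -(normN hN s') -(normN hN s); apply: flat_mono; lra.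
Qed.

Lemma flat_monoN_lt s s' w : s < s' -> s' <= 0 -> `|w| < N s w ->
  N s' w < N s w.
Proof.
move=> ss' s'0; rewrite -(normN hN s') -(normN hN s) -normrN => h.
by apply: flat_mono_lt => //; lra.
Qed.

(** Along a horizontal line the norm is convex with minimum [|w|] at [0], and strictly monotone on
    either side wherever it exceeds that minimum; a plateau therefore sits at the minimum. This is
    how norms reveal heights. *)
Lemma flat_const s s' w M : s < s' ->
  (forall r, s <= r -> r <= s' -> N r w = M) -> M = `|w|.
Proof.
move=> ss' h; apply/eqP; rewrite eq_le; apply/andP; split; last first.
  by rewrite -(h s) ?flat_ge_norm//; lra.
rewrite leNgt; apply/negP => wM.
have hs := h s ltac:(lra) ltac:(lra).
have hs' := h s' ltac:(lra) ltac:(lra).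
have [s0|s0] := leP 0 s.
  have : N s w < N s' w by apply: flat_mono_lt => //; rewrite hs'.
  by rewrite hs hs' ltxx.
have [s'0|s'0] := leP s' 0.
  have : N s' w < N s w by apply: flat_monoN_lt => //; rewrite hs.
  by rewrite hs hs' ltxx.
by have := h 0 ltac:(lra) ltac:(lra); rewrite flat_norm0; lra.
Qed.

Lemma flat_hor_le1 : N 1 0 <= 1.
Proof.
have := norm_triangle hN 1 1 1 (-1).
rewrite subrr -(normN hN 1 (-1)) opprK !flatN//; try lra.
by have := norm_hor hN (1 + 1); rewrite ger0_norm; lra.
Qed.

Lemma flat_box s w : -1 <= w -> w <= 1 -> -1 <= s -> s <= 1 -> N s w <= 1.
Proof.
move=> w1 w2 s1 s2.
have := @norm_comb_eq _ _ hN s 1 s (-1) ((1 + w) / 2) ((1 - w) / 2) s w.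
rewrite -(normN hN s (-1)) opprK !flatN//; try lra.
Qed.

Lemma flat_face_end : exists b,
  [/\ 1 <= b, N b 1 = 1 & forall s, b < s -> 1 < N s 1].
Proof.
have c0 := norm10_gt0 hN.
(* With this choice [N M 1 >= 3 - N 0 1 = 2]. *)
pose M := 3 / N 1 0.
have M0 : 0 < M by rewrite divr_gt0//; lra.
have M1 : 1 <= M by rewrite ler_pdivlMr//; have := flat_hor_le1; lra.
have fM : 1 < N M 1.
  have := norm_lip hN M 0 M 1; rewrite subrr sub0r -(normN hN 0) oppr0 opprK.
  rewrite (norm_hor hN M) flat_norm0 normr1 gtr0_norm// /M divfK ?gt_eqF//.
  lra.
have lip x y : N x 1 <= N y 1 + N 1 0 * `|x - y|.
  by have := norm_lip hN x 1 y 1; rewrite subrr (norm_hor hN (x - y)) mulrC.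
have [|b [b1 bM Nb after]] := last_crossing lip M1 _ fM.
  by rewrite flatN//; lra.
exists b; split=> // s bs; have [sM|Ms] := leP s M; first exact: after.
by apply: lt_le_trans fM _; apply: flat_mono; lra.
Qed.

End FlatNorm.

(** * Continuation past a face *)

Definition fixed_face (R : realType) (N1 N2 : R -> R -> R)
    (J : R -> R -> R -> R -> Prop) : Prop :=
  [/\ planar_norm N1, planar_norm N2, planar_isom N1 N2 J &
      forall s, -1 <= s -> s <= 1 -> J s 1 s 1 /\ J (- s) (-1) (- s) (-1)].

Lemma fixed_face_sym (R : realType) (N1 N2 : R -> R -> R) J :
  fixed_face N1 N2 J -> fixed_face N2 N1 (fun a b c d => J c d a b).
Proof. by move=> [n1 n2 iso fix0]; split=> //; exact: planar_isom_sym. Qed.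

Lemma fixed_face_neg (R : realType) (N1 N2 : R -> R -> R) J :
  fixed_face N1 N2 J ->
  fixed_face N1 N2 (fun a b c d => J (- a) (- b) (- c) (- d)).
Proof.
move=> [n1 n2 iso fix0]; split=> //; first exact: planar_isom_neg.
by move=> s s1 s2; have [] := fix0 s s1 s2; rewrite !opprK.
Qed.

Section FixedFace.
Context {R : realType} (N1 N2 : R -> R -> R) (J : R -> R -> R -> R -> Prop).
Hypothesis hJ : fixed_face N1 N2 J.
Implicit Types (a b s u w : R).

Let n1 : planar_norm N1. Proof. by case: hJ. Qed.
Let n2 : planar_norm N2. Proof. by case: hJ. Qed.

Lemma fixed_face_sphere u w u' w' : J u w u' w' -> N1 u w = 1 /\ N2 u' w' = 1.
Proof. by case: hJ => _ _ [h _ _ _] _; exact: h. Qed.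

Lemma fixed_face_flat1 s : -1 <= s -> s <= 1 -> N1 s 1 = 1.
Proof.
by case: hJ => _ _ _ h s1 s2; have [/fixed_face_sphere[]] := h s s1 s2.
Qed.

Lemma fixed_face_flat2 s : -1 <= s -> s <= 1 -> N2 s 1 = 1.
Proof.
by case: hJ => _ _ _ h s1 s2; have [/fixed_face_sphere[]] := h s s1 s2.
Qed.

Let f1 := fixed_face_flat1.
Let f2 := fixed_face_flat2.

Lemma fixed_face_top u w u' w' s : J u w u' w' -> -1 <= s -> s <= 1 ->
  N1 (u - s) (w - 1) = N2 (u' - s) (w' - 1).
Proof.
case: hJ => _ _ [_ _ _ h] fix0 j s1 s2; have [j' _] := fix0 s s1 s2.
exact: h j j'.
Qed.

Lemma fixed_face_bot u w u' w' s : J u w u' w' -> -1 <= s -> s <= 1 ->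
  N1 (u + s) (w + 1) = N2 (u' + s) (w' + 1).
Proof.
case: hJ => _ _ [_ _ _ h] fix0 j s1 s2; have [_ j'] := fix0 s s1 s2.
by have := h _ _ _ _ _ _ _ _ j j'; rewrite !opprK.
Qed.

Lemma fixed_face_hor : N1 1 0 = N2 1 0.
Proof.
have [j _] : J 1 1 1 1 /\ J (-1) (-1) (-1) (-1).
  by case: hJ => _ _ _ h; apply: h => //; lra.
have := @fixed_face_top _ _ _ _ (-1) j; rewrite subrr opprK.
rewrite (norm_hor n1 (1 + 1)) (norm_hor n2 (1 + 1)) => e.
apply: (@mulfI _ `|1 + 1 : R|); first by rewrite normr_eq0; lra.
by apply: e; lra.
Qed.

(* Summing with the points of the face measures the height, as long as the sum
   stays in the cone over the face. *)
Lemma fixed_face_height u w u' w' a b : J u w u' w' ->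
  -1 <= a -> a < b -> b <= 1 ->
  (forall s, a <= s -> s <= b -> N1 (u + s) (w + 1) = w + 1) -> w' = w.
Proof.
move=> j a1 ab b1 h.
have [h1 h2] := fixed_face_sphere j.
have w'1 : -1 <= w' /\ w' <= 1.
  have := flat_ge n2 f2 u' w'; have := flat_ge n2 f2 (- u') (- w').
  by rewrite (normN n2) h2; lra.
have := @flat_const _ _ n2 f2 (u' + a) (u' + b) (w' + 1) (w + 1).
rewrite ger0_norm; last by lra.
move=> e; suff : w + 1 = w' + 1 by lra.
apply: e; first by lra.
move=> r ar rb; rewrite -(h (r - u')); [|lra|lra].
by rewrite (fixed_face_bot j)//; [congr N2; ring|lra|lra].
Qed.

(** At the height of the face all differences are horizontal, and the distances to the two ends
    determine the point. *)
Lemma fixed_face_level u u' w : J u w u' w -> w = 1 -> u' = u.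
Proof.
move=> j w1; subst w.
have c0 := norm10_gt0 n1.
have e s : -1 <= s -> s <= 1 -> `|u - s| = `|u' - s|.
  move=> s1 s2; have := fixed_face_top j s1 s2.
  rewrite subrr (norm_hor n1 (u - s)) (norm_hor n2 (u' - s)) -fixed_face_hor.
  by apply: mulIf; rewrite gt_eqF.
have /eqP := e 1 ltac:(lra) ltac:(lra).
have /eqP := e (-1) ltac:(lra) ltac:(lra).
by rewrite !eqr_norm2 => /orP[/eqP|/eqP] ? /orP[/eqP|/eqP] ?; lra.
Qed.

(** The face may be longer than its known fixed part. Sums of its points with fixed ones still have
    norm exactly [2], which determines the height of the image. *)
Lemma fixed_face_extend s : N1 s 1 = 1 -> J s 1 s 1.
Proof.
move=> h; have [u' [w' j]] : exists u' w', J s 1 u' w'.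
  by case: hJ => _ _ [_ ex _ _] _; exact: ex.
have e : w' = 1.
  apply: (@fixed_face_height _ _ _ _ (-1) 1 j); rewrite ?lerr//; try lra.
  move=> r r1 r2; apply/eqP; rewrite eq_le (flat_ge n1 f1) andbT.
  by have := norm_triangle n1 s 1 r 1; rewrite h f1//; lra.
subst w'; have e := fixed_face_level j erefl; by subst u'.
Qed.

End FixedFace.

(** Maximality of the face with ends [(-1, 1)] and [(1, 1)], in a homogeneous form that applies at
    every height, including [0]. *)
Definition sharp_face (R : realType) (N : R -> R -> R) : Prop :=
  forall s w, `|w| < `|s| -> `|w| < N s w.

Lemma sharp_face_ends (R : realType) (N : R -> R -> R) : planar_norm N ->
  (forall s, 1 < s -> 1 < N s 1) -> (forall s, s < -1 -> 1 < N s 1) ->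
  sharp_face N.
Proof.
move=> hN right left s w ws; have [w0|w0] := eqVneq w 0.
  rewrite w0 normr0 lt_neqAle norm_ge0// andbT eq_sym; apply/eqP.
  by move=> /(norm_eq0 hN)[s0 _]; move: ws; rewrite w0 s0 normr0 ltxx.
have -> : N s w = N (w * (s / w)) (w * 1) by congr N; field.
rewrite (norm_scale hN) ltr_pMr ?normr_gt0//.
have : 1 < `|s / w| by rewrite normf_div ltr_pdivlMr ?normr_gt0// mul1r.
by rewrite ltr_normr => /orP[|] h; [apply: right|apply: left; lra].
Qed.

Section SharpFace.
Context {R : realType} (N1 N2 : R -> R -> R) (J : R -> R -> R -> R -> Prop).
Hypothesis hJ : fixed_face N1 N2 J.
Hypothesis sharp1 : sharp_face N1.
Hypothesis sharp2 : sharp_face N2.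
Implicit Types (a b s u w : R).

Let n1 : planar_norm N1. Proof. by case: hJ. Qed.
Let n2 : planar_norm N2. Proof. by case: hJ. Qed.
Let f1 := fixed_face_flat1 hJ.
Let f2 := fixed_face_flat2 hJ.

(** The ball contains the square spanned by the face and its opposite, so a point strictly between
    the two faces in height can be on the sphere only outside the open square. *)
Lemma flat_sphere_ge1 (N : R -> R -> R) u w : planar_norm N ->
  (forall s, -1 <= s -> s <= 1 -> N s 1 = 1) ->
  0 <= u -> -1 < w -> w < 1 -> N u w = 1 -> 1 <= u.
Proof.
move=> n f u0 w1 w2 Nu; rewrite leNgt; apply/negP => u1.
have le1 := @flat_box _ _ n f 1 w ltac:(lra) ltac:(lra) ltac:(lra) ltac:(lra).
have := flat_mono n f w u0 (ltW u1).
rewrite Nu => ge1.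
have : N u w < N 1 w.
  apply: (flat_mono_lt n f u0 u1); apply: lt_le_trans ge1.
  by rewrite ltr_norml; lra.
lra.
Qed.

Lemma flat_sphere_uniq (N : R -> R -> R) u u' w : planar_norm N ->
  (forall s, -1 <= s -> s <= 1 -> N s 1 = 1) -> `|w| < 1 ->
  0 <= u -> 0 <= u' -> N u w = 1 -> N u' w = 1 -> u = u'.
Proof.
move=> n f w1 u0 u'0 h h'; have [uu'|uu'|//] := ltgtP u u'.
  by have := flat_mono_lt n f u0 uu' (w := w); rewrite h h' ltxx => /(_ w1).
by have := flat_mono_lt n f u'0 uu' (w := w); rewrite h h' ltxx => /(_ w1).
Qed.

Lemma sharp_face_height u w u' w' : J u w u' w' ->
  0 <= u -> 0 <= w -> w < 1 -> u < 2 + w ->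
  [/\ w' = w, 1 <= u' & u' < 2 + w].
Proof.
move=> j u0 w0 w1 u2; have [h1 h2] := fixed_face_sphere hJ j.
have u1 : 1 <= u by apply: (flat_sphere_ge1 n1 f1) h1; lra.
(* The sum [(u + s, w + 1)] stays in the cone over the face as long as [s <= 1 + w - u]; the
   hypothesis [u < 2 + w] makes room for such [s] above [-1]. *)
pose b := Num.min 1 (1 + w - u).
have b1 : b <= 1 by rewrite /b ge_min lexx.
have b2 : b <= 1 + w - u by rewrite /b ge_min lexx orbT.
have b3 : -1 < b by rewrite /b lt_min; lra.
have bot s : -1 <= s -> s <= b -> N1 (u + s) (w + 1) = w + 1.
  by move=> s1 s2; apply: (flat_in n1 f1); lra.
have e := @fixed_face_height _ _ _ _ hJ _ _ _ _ (-1) b j ltac:(lra) b3 b1 bot.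
subst w'.
(* The point is strictly closer to [(1, 1)] than to [(-1, 1)], which fails for a point of the left
   arc. *)
have u'0 : 0 <= u'.
  rewrite leNgt; apply/negP => u'0.
  have u'1 : 1 <= - u'.
    rewrite leNgt; apply/negP => u'1.
    have le1 := @flat_box _ _ n2 f2 (-1) w
      ltac:(lra) ltac:(lra) ltac:(lra) ltac:(lra).
    have := @flat_monoN_lt _ _ n2 f2 (-1) u' w ltac:(lra) ltac:(lra).
    have ge1 := @flat_monoN _ _ n2 f2 (-1) u' w ltac:(lra) ltac:(lra).
    have : `|w| < N2 (-1) w by rewrite ger0_norm//; lra.
    by move=> + h => /h; lra.
  have t1 := @fixed_face_top _ _ _ _ hJ _ _ _ _ 1 j ltac:(lra) ltac:(lra).
  have t2 := @fixed_face_top _ _ _ _ hJ _ _ _ _ (-1) j ltac:(lra) ltac:(lra).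
  have : N1 (u - 1) (w - 1) < N1 (u - -1) (w - 1).
    apply: (flat_mono_lt n1 f1); [lra|lra|].
    by apply: sharp1; rewrite ltr0_norm ?ger0_norm; lra.
  rewrite t1 t2 ltNge => /negP; apply.
  by apply: (flat_monoN n2 f2); lra.
split=> //; first by apply: (flat_sphere_ge1 n2 f2) h2; lra.
(* Otherwise the sum with [(b, 1)] leaves the cone over the face, where sharpness makes its norm
   exceed its height. *)
rewrite ltNge; apply/negP => u'2.
have := @fixed_face_bot _ _ _ _ hJ _ _ _ _ b j ltac:(lra) b1.
rewrite bot//; last by lra.
have := sharp2 (s := u' + b) (w := w + 1).
rewrite !ger0_norm; lra.
Qed.

Lemma sharp_face_point w : 0 <= w -> w < 1 -> 1 < N1 (2 + w) w ->
  exists u, [/\ 1 <= u, u < 2 + w & N1 u w = 1].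
Proof.
move=> w0 w1 h.
have lip x y : N1 x w <= N1 y w + N1 1 0 * `|x - y|.
  by have := norm_lip n1 x w y w; rewrite subrr (norm_hor n1 (x - y)) mulrC.
have [||u [u1 u2 Nu _]] := last_crossing lip (a := 1) _ _ h; first by lra.
  by apply: (flat_box n1 f1); lra.
by exists u.
Qed.

(** The sphere point at height [w] left of the line [u = 2 + w] keeps its height and stays left of
    the line, so the line is outside the second ball as well. Applied also to the inverse, this
    makes both spheres meet the line at the same height. *)
Lemma sharp_face_crossing w : 0 <= w -> w < 1 -> 1 < N1 (2 + w) w ->
  1 < N2 (2 + w) w.
Proof.
move=> w0 w1 h; have [u [u1 u2 Nu]] := sharp_face_point w0 w1 h.
have [u' [w' j]] : exists u' w', J u w u' w'.
  by case: hJ => _ _ [_ ex _ _] _; exact: ex.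
have [e u'1 u'2] := @sharp_face_height _ _ _ _ j ltac:(lra) w0 w1 u2.
subst w'; have [_ Nu'] := fixed_face_sphere hJ j.
rewrite -[X in X < _]Nu'.
apply: (flat_mono_lt n2 f2 _ u'2); first by lra.
by apply: sharp2; rewrite !ger0_norm; lra.
Qed.

End SharpFace.

Section SharpFaceDescent.
Context {R : realType} (N1 N2 : R -> R -> R) (J : R -> R -> R -> R -> Prop).
Hypothesis hJ : fixed_face N1 N2 J.
Hypothesis sharp1 : sharp_face N1.
Hypothesis sharp2 : sharp_face N2.
Implicit Types (a b h s u w : R).

Let n1 : planar_norm N1. Proof. by case: hJ. Qed.
Let n2 : planar_norm N2. Proof. by case: hJ. Qed.
Let f1 := fixed_face_flat1 hJ.
Let f2 := fixed_face_flat2 hJ.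

(** The vector [(1 + w) (2, 0)] is [(2 + w, w)] plus [w] times the unit vector [(1, -1)]. *)
Lemma sharp_face_ray w : 1 < N1 2 0 -> 0 < w -> 1 < N1 (2 + w) w.
Proof.
move=> h w0.
have := @norm_comb_eq _ _ n1 1 (-1) (2 + w) w w 1
  ((1 + w) * 2) ((1 + w) * 0) ltac:(lra) ler01 ltac:(ring) ltac:(ring).
rewrite (norm_scale_ge0 n1 2 0); last by lra.
rewrite -(normN n1 1) opprK (f1 (s := -1)); [|lra|lra].
have : 0 < (1 + w) * (N1 2 0 - 1) by rewrite mulr_gt0//; lra.
lra.
Qed.

(** The sphere point at height [w] is squeezed between the line [u = 2 + w] and the chord from
    [(2 + w0, w0)] to [(1, 1)], whose abscissa at that height is [U]. In units of [d] the horizontal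
    error is at most [2] and the vertical one at most [1], whence the constant [3]. *)
Lemma sharp_face_near (N : R -> R -> R) u w w0 : planar_norm N ->
  (forall s, -1 <= s -> s <= 1 -> N s 1 = 1) -> sharp_face N ->
  0 <= w0 -> w0 < w -> w < 1 ->
  N (2 + w0) w0 = 1 -> N u w = 1 -> 1 <= u -> u < 2 + w ->
  N (2 + w0 - u) (w0 - w) <= 3 / (1 - w0) * (w - w0).
Proof.
move=> n f sharpN w00 ww0 w1 N0 Nu u1 u2.
pose d := (w - w0) / (1 - w0).
have w01 : 0 < 1 - w0 by lra.
have d0 : 0 < d by rewrite divr_gt0// subr_gt0.
have d1 : d < 1 by rewrite ltr_pdivrMr//; lra.
have dE : d * (1 - w0) = w - w0 by rewrite divfK// gt_eqF.
pose U := 2 + w0 - d * (1 + w0).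
have NU : N U w <= 1.
  have := @norm_comb_eq _ _ n (2 + w0) w0 1 1 (1 - d) d U w
    ltac:(lra) (ltW d0).
  rewrite N0 f; [|lra|lra] => e.
  by apply: le_trans (e _ _) _; rewrite /U; lra.
have Uu : U <= u.
  rewrite leNgt; apply/negP => uU.
  suff : N u w < N U w by lra.
  apply: (flat_mono_lt n f _ uU); first by lra.
  by apply: sharpN; rewrite !ger0_norm; lra.
have dw : d * w0 < d by rewrite gtr_pMr//; lra.
have wd : w - w0 <= d by rewrite -dE ler_piMr//; lra.
apply: le_trans (norm_le_coord n _ _) _.
rewrite (f 0); [|lra|lra].
have := flat_hor_le1 n f; have := norm10_gt0 n => c0 c1.
have h1 : `|2 + w0 - u| <= 2 * d.
  by rewrite ler_norml; move: Uu; rewrite /U; lra.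
have h2 : `|w0 - w| <= d by rewrite ler_norml; lra.
have h3 : `|2 + w0 - u| * N 1 0 <= 2 * d * 1 by apply: ler_pM => //; lra.
have -> : 3 / (1 - w0) * (w - w0) = 3 * d by rewrite /d; ring.
lra.
Qed.

(** Heights are controlled only strictly left of the line, so its point on the sphere is handled as
    a limit from above: nearby sphere points and their images, at equal heights, both approach
    it. *)
Lemma sharp_face_limit w0 y1 y2 : 0 <= w0 -> w0 < 1 ->
  N2 (2 + w0) w0 = 1 -> (forall w, w0 < w -> w < 1 -> 1 < N1 (2 + w) w) ->
  J (2 + w0) w0 y1 y2 -> 2 + w0 = y1 /\ w0 = y2.
Proof.
move=> w00 w01 Nw0 above j.
have [Mw0 _] := fixed_face_sphere hJ j.
suff : N2 (2 + w0 - y1) (w0 - y2) = 0 by move=> /(norm_eq0 n2); lra.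
apply/eqP; rewrite eq_le norm_ge0// andbT leNgt; apply/negP => D0.
set D := N2 _ _ in D0.
(* Twice the constant of [sharp_face_near], which is used once for each norm. *)
pose K := 6 / (1 - w0).
have K0 : 0 < K by rewrite divr_gt0//; lra.
pose e := Num.min (D / (2 * K)) ((1 - w0) / 2).
have e0 : 0 < e by rewrite lt_min !divr_gt0//; lra.
have eD : K * e < D.
  have : e <= D / (2 * K) by rewrite /e ge_min lexx.
  by rewrite ler_pdivlMr; lra.
have e1 : e <= (1 - w0) / 2 by rewrite /e ge_min lexx orbT.
have [w wE] : exists w, w = w0 + e by exists (w0 + e).
have hw := above w ltac:(lra) ltac:(lra).
have [u [u1 u2 Nu]] :=
  sharp_face_point hJ (w := w) ltac:(lra) ltac:(lra) hw.
have [u' [w' j']] : exists u' w', J u w u' w'.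
  by case: hJ => _ _ [_ ex _ _] _; exact: ex.
have [||||ew u'1 u'2] := sharp_face_height hJ sharp1 sharp2 j'; try lra.
subst w'; have [_ Nu'] := fixed_face_sphere hJ j'.
have h1 : N1 (2 + w0 - u) (w0 - w) <= 3 / (1 - w0) * (w - w0).
  by apply: sharp_face_near => //; lra.
have h2 : N2 (2 + w0 - u') (w0 - w) <= 3 / (1 - w0) * (w - w0).
  by apply: sharp_face_near => //; lra.
have h3 : N1 (2 + w0 - u) (w0 - w) = N2 (y1 - u') (y2 - w).
  by case: hJ => _ _ [_ _ _ dist] _; exact: dist j j'.
have h4 := norm_triangle n2 (2 + w0 - u') (w0 - w) (u' - y1) (w - y2).
move: h4; rewrite (norm_sub_sym n2 u') -h3.
have -> : N2 (2 + w0 - u' + (u' - y1)) (w0 - w + (w - y2)) = D.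
  by rewrite /D; congr N2; ring.
have eK : 3 / (1 - w0) * (w - w0) = K * e / 2.
  by rewrite /K wE; field; lra.
rewrite eK in h1 h2.
lra.
Qed.
End SharpFaceDescent.

Section SharpFaceFixed.
Context {R : realType} (N1 N2 : R -> R -> R) (J : R -> R -> R -> R -> Prop).
Hypothesis hJ : fixed_face N1 N2 J.
Hypothesis sharp1 : sharp_face N1.
Hypothesis sharp2 : sharp_face N2.
Implicit Types (a b h s u w : R).

Let n1 : planar_norm N1. Proof. by case: hJ. Qed.
Let n2 : planar_norm N2. Proof. by case: hJ. Qed.
Let f1 := fixed_face_flat1 hJ.
Let f2 := fixed_face_flat2 hJ.

(* The line [u = 2 + w] passes through [(1, -1)], the opposite of the left end
   of the face: it bounds the points of the right arc whose sum with that end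
   lies over the face. *)
Lemma sharp_face_start : exists w0 u0,
  [/\ 0 <= w0 < 1, 1 <= u0 <= 3, J u0 w0 u0 w0 &
      forall w, w0 < w -> w < 1 -> 1 < N1 (2 + w) w].
Proof.
have total u w : N1 u w = 1 -> exists u' w', J u w u' w'.
  by case: hJ => _ _ [_ ex _ _] _; exact: ex.
have c0 := norm10_gt0 n1; have c1 := flat_hor_le1 n1 f1.
have N20 : N1 2 0 = 2 * N1 1 0 by rewrite (norm_hor n1 2) ger0_norm.
have N20' : N2 2 0 = 2 * N1 1 0.
  by rewrite (norm_hor n2 2) ger0_norm// (fixed_face_hor hJ).
(* In the first case the line is outside the ball at every height [w >= 0]. The start is then on the
   horizontal axis: its height is preserved, and [N1 1 0 = N2 1 0] gives its abscissa. *)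
have [big|small] := ltP 1 (N1 2 0).
  pose u := (N1 1 0)^-1.
  have cu : u * N1 1 0 = 1 by rewrite mulVf// gt_eqF.
  have u1 : 1 <= u by rewrite invf_ge1.
  have u2 : u < 2.
    by rewrite -(ltr_pM2r c0) cu; lra.
  have Nu : N1 u 0 = 1 by rewrite (norm_hor n1 u) ger0_norm//; lra.
  have [u' [w' j]] := total _ _ Nu.
  have [||||e u'1 u'2] := sharp_face_height hJ sharp1 sharp2 j; try lra.
  subst w'; have [_ Nu'] := fixed_face_sphere hJ j.
  have eu : u' = u.
    have cn0 : N1 1 0 != 0 by rewrite gt_eqF.
    apply: (mulIf cn0).
    move: Nu'; rewrite (norm_hor n2 u') -(fixed_face_hor hJ) ger0_norm; lra.
  subst u'; exists 0, u; split=> //; first by rewrite lexx ltr01.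
    by rewrite u1 /=; lra.
  by move=> w w0 _; exact: (sharp_face_ray hJ).
have lip (N : R -> R -> R) : planar_norm N -> forall x y,
    N (2 + x) x <= N (2 + y) y + N 1 1 * `|x - y|.
  move=> n x y; have := norm_lip n (2 + x) x (2 + y) y.
  have -> : N (2 + x - (2 + y)) (x - y) = N ((x - y) * 1) ((x - y) * 1).
    by congr N; ring.
  by rewrite (norm_scale n) mulrC.
have [||w0 [w00 w01 Nw0 above1]] := last_crossing (lip _ n1) ler01.
- by rewrite addr0.
- by have := @sharp1 (2 + 1) 1; rewrite normr1 ger0_norm; lra.
have [||w0' [w00' w01' Nw0' above2]] := last_crossing (lip _ n2) ler01.
- by rewrite addr0 N20' -N20.
- by have := @sharp2 (2 + 1) 1; rewrite normr1 ger0_norm; lra.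
have ew : w0' = w0.
  have [lt|lt|//] := ltgtP w0' w0.
    have := above2 w0 lt (ltW w01).
    move=> /(sharp_face_crossing (fixed_face_sym hJ) sharp2 sharp1 w00 w01).
    by rewrite Nw0 ltxx.
  have := above1 w0' lt (ltW w01').
  move=> /(sharp_face_crossing hJ sharp1 sharp2 w00' w01').
  by rewrite Nw0' ltxx.
subst w0'; have [u' [w' j]] := total _ _ Nw0.
have above w : w0 < w -> w < 1 -> 1 < N1 (2 + w) w.
  by move=> h1 h2; apply: above1 => //; exact: ltW.
have [e1 e2] := sharp_face_limit hJ sharp1 sharp2 w00 w01 Nw0' above j.
subst w'; subst u'; exists w0, (2 + w0); split=> //; first by rewrite w00.
by apply/andP; split; lra.
Qed.

(* With [r = (u + 1) / h], the vectors [(u2 - s, - h')] and [(r h', - h')]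
   coincide, and the latter is a multiple of the difference between the fixed
   points [(u, 1 - h)] and [(-1, 1)]. *)
Lemma sharp_face_descent h h' u u1 u2 : 0 < h -> h <= 1 -> h' <= h ->
  2 * h <= 3 * h' -> 1 <= u -> u <= 3 -> J u (1 - h) u (1 - h) ->
  1 <= u1 -> 1 <= u2 -> J u1 (1 - h') u2 (1 - h') -> u1 = u2.
Proof.
move=> h0 h1 h'h hh' u_1 u_3 j u1_1 u2_1 j'.
have [Nu Mu] := fixed_face_sphere hJ j.
have [Nu1 Mu2] := fixed_face_sphere hJ j'.
pose k := h' / h.
have kh : k * h = h' by rewrite divfK// gt_eqF.
have k23 : 2 / 3 <= k by rewrite ler_pdivlMr//; lra.
have k1 : k <= 1 by rewrite ler_pdivrMr//; lra.
pose s := u2 - k * (u + 1).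
(* The chord from [(-1, 1)] to [(u, 1 - h)] lies in the ball and has abscissa [k * (u + 1) - 1] at
   height [1 - h'], so [u2] cannot be smaller. *)
have s1 : -1 <= s.
  rewrite leNgt; apply/negP => s1.
  have le1 := @norm_comb_eq _ _ n2 (-1) 1 u (1 - h) (1 - k) k
    (k * (u + 1) - 1) (1 - h') ltac:(lra) ltac:(lra) ltac:(ring)
    ltac:(rewrite -kh; ring).
  rewrite Mu f2 in le1; [|lra|lra].
  suff : N2 u2 (1 - h') < N2 (k * (u + 1) - 1) (1 - h') by lra.
  apply: (flat_mono_lt n2 f2); [lra|rewrite /s in s1; lra|].
  by apply: sharp2; rewrite /s in s1; rewrite !ger0_norm; lra.
(* The chord from [(u2, 1 - h')] to [(1, -1)] has abscissa [1 + t * (u2 - 1)] at height [1 - h],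
   hence at most [u]. If [s > 1], then [t * k * (u + 1) < u - 1]; since [t * k >= 3/4 * 2/3 = 1/2],
   this contradicts [u <= 3]. *)
have s2 : s <= 1.
  rewrite leNgt; apply/negP => s2.
  pose t := (2 - h) / (2 - h').
  have th : t * (2 - h') = 2 - h by rewrite divfK// gt_eqF//; lra.
  have t34 : 3 / 4 <= t by rewrite ler_pdivlMr; lra.
  have t1 : t <= 1 by rewrite ler_pdivrMr; lra.
  have le1 := @norm_comb_eq _ _ n2 u2 (1 - h') 1 (-1) t (1 - t)
    (1 + t * (u2 - 1)) (1 - h) ltac:(lra) ltac:(lra) ltac:(ring) ltac:(lra).
  rewrite Mu2 -(normN n2 1) opprK (f2 (s := -1)) in le1; [|lra|lra].
  have : 1 + t * (u2 - 1) <= u.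
    rewrite leNgt; apply/negP => gtu.
    suff : N2 u (1 - h) < N2 (1 + t * (u2 - 1)) (1 - h) by lra.
    apply: (flat_mono_lt n2 f2 _ gtu); first by lra.
    by apply: sharp2; rewrite !ger0_norm; lra.
  have : t * (k * (u + 1)) < t * (u2 - 1).
    by rewrite ltr_pM2l; rewrite /s in s2; lra.
  have : 3 / 4 * (2 / 3 * (u + 1)) <= t * (k * (u + 1)).
    apply: ler_pM => //; try lra.
    by rewrite ler_wpM2r//; lra.
  lra.
have e1 := fixed_face_top hJ j' s1 s2.
have m1 : -1 <= -1 :> R by [].
have e2 := fixed_face_top hJ j m1 ltac:(lra).
have e3 : N1 (u1 - s) (- h') = N1 (u2 - s) (- h').
  have -> : - h' = 1 - h' - 1 by ring.
  have -> : u2 - s = k * (u - -1) by rewrite /s; ring.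
  have -> : 1 - h' - 1 = k * (1 - h - 1) by rewrite -kh; ring.
  rewrite (norm_scale_ge0 n1); last by lra.
  rewrite e2 -(norm_scale_ge0 n2); last by lra.
  rewrite (_ : k * (1 - h - 1) = 1 - h' - 1); last by rewrite -kh; ring.
  rewrite e1; congr N2; rewrite /s; ring.
have gt : `|- h'| < N1 (u2 - s) (- h').
  apply: sharp1; rewrite normrN !ger0_norm; try lra.
    have -> : u2 - s = k * (u + 1) by rewrite /s; ring.
    have : k * 2 <= k * (u + 1) by rewrite ler_pM2l; lra.
    lra.
have [lt|lt|//] := ltgtP u1 u2.
  have := @flat_mono_lt _ _ n1 f1 (u1 - s) (u2 - s) (- h')
    ltac:(lra) ltac:(lra) gt.
  by rewrite e3 ltxx.
rewrite -e3 in gt.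
have := @flat_mono_lt _ _ n1 f1 (u2 - s) (u1 - s) (- h')
  ltac:(lra) ltac:(lra) gt.
by rewrite e3 ltxx.
Qed.

(** Depths are measured below the face. One descent leads from depth [g] to any depth between
    [2/3 * g] and [g], so iteration comes arbitrarily close to the face. The bound [u <= 3] persists
    because the points reached satisfy [u < 2 + w] with [w < 1]. *)
Lemma sharp_face_arc : exists2 w0, 0 <= w0 < 1 &
  forall u w, 0 <= u -> w0 < w -> w < 1 -> N1 u w = 1 -> J u w u w.
Proof.
have [w0 [u0 [/andP[w00 w01] /andP[u01 u03] j0 above]]] := sharp_face_start.
exists w0; first by rewrite w00.
pose h0 := 1 - w0.
have h00 : 0 < h0 by rewrite /h0; lra.
have P n h : (2 / 3) ^+ n * h0 <= h -> h <= h0 ->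
    exists u, [/\ 1 <= u, u <= 3 & J u (1 - h) u (1 - h)].
  elim: n h => [|n IH] h.
    rewrite expr0 mul1r => h1 h2; have -> : h = h0 by lra.
    by exists u0; rewrite /h0 opprB addrC subrK.
  rewrite exprS -mulrA => h1 h2.
  have [e|ne] := eqVneq h h0.
    by exists u0; rewrite e /h0 opprB addrC subrK.
  have hh0 : h < h0 by rewrite lt_neqAle ne.
  pose g := Num.min h0 (3 / 2 * h).
  have pos : 0 < (2 / 3 : R) ^+ n * h0 by rewrite mulr_gt0// exprn_gt0//; lra.
  have h_0 : 0 < h by lra.
  have gh0 : g <= h0 by rewrite /g ge_min lexx.
  have gh : g <= 3 / 2 * h by rewrite /g ge_min lexx orbT.
  have hg : h <= g by rewrite /g le_min; apply/andP; split; lra.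
  have le_g : (2 / 3) ^+ n * h0 <= g.
    rewrite /g le_min; apply/andP; split; last by lra.
    by rewrite ger_pMl// exprn_ile1; lra.
  have [u [u1 u3 j]] := IH g le_g gh0.
  have hw := above (1 - h) ltac:(rewrite /h0 in hh0; lra) ltac:(lra).
  have [u' [u'1 u'2 Nu']] := sharp_face_point hJ (w := 1 - h)
    ltac:(rewrite /h0 in hh0; lra) ltac:(lra) hw.
  have [u'' [w'' j']] : exists a b, J u' (1 - h) a b.
    by case: hJ => _ _ [_ ex _ _] _; exact: ex.
  have [||||e u''1 _] := sharp_face_height hJ sharp1 sharp2 j';
    rewrite /h0 in hh0; try lra.
  subst w''.
  have e := @sharp_face_descent g h u u' u'' ltac:(lra)
    ltac:(rewrite /h0 in gh0; lra) hg ltac:(lra) u1 u3 j u'1 u''1 j'.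
  by subst u''; exists u'; split=> //; lra.
move=> u w u_0 w0w w1 Nu.
have [n hn] : exists n, (2 / 3) ^+ n * h0 <= 1 - w.
  have w10 : 0 < 1 - w by lra.
  have pos n : 0 < (2 / 3 : R) ^+ n by rewrite exprn_gt0//; lra.
  (* Bernoulli's inequality for the powers of [3/2]. *)
  have bern n : (2 / 3 : R) ^+ n * (1 + n%:R / 2) <= 1.
    elim: n => [|n IH]; first by rewrite expr0 mul0r addr0 mul1r.
    move: IH (pos n); rewrite exprS -(natr1 n).
    move: (_ ^+ n) (n%:R) (ler0n R n) => k m m0 IH k0.
    have : 0 <= k * m by rewrite mulr_ge0// ltW.
    lra.
  pose n := Num.bound (2 / (1 - w)); exists n.
  have hb : 2 / (1 - w) < n%:R.
    by apply: archi_boundP; rewrite divr_ge0//; lra.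
  have : 2 < n%:R * (1 - w) by rewrite -ltr_pdivrMr.
  have := bern n; have := pos n.
  set k := _ ^+ n; set m := n%:R => k0 b1 b2.
  have : k * 2 < k * (m * (1 - w)) by rewrite ltr_pM2l.
  have : k * h0 <= k by rewrite ger_pMr// /h0; lra.
  have : k * (m / 2) * (1 - w) <= 1 * (1 - w).
    by rewrite ler_pM2r//; lra.
  lra.
have [u' [u'1 _ j]] := P n (1 - w) hn ltac:(rewrite /h0; lra).
move: j; rewrite opprB addrC subrK => j.
have [Nu' _] := fixed_face_sphere hJ j.
have <- // : u' = u.
apply: (@flat_sphere_uniq _ N1 _ _ w n1 f1) => //; last by lra.
by rewrite ger0_norm; lra.
Qed.

End SharpFaceFixed.

Lemma planar_norm_reflect (R : realType) (N : R -> R -> R) :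
  planar_norm N -> planar_norm (fun a b => N (- a) b).
Proof.
move=> n; split.
- by move=> a b c d; rewrite opprD; exact: norm_triangle.
- by move=> k a b; rewrite -mulrN (norm_scale n).
- by move=> a b /(norm_eq0 n)[/eqP]; rewrite oppr_eq0 => /eqP.
Qed.

Section FaceExtension.
Context {R : realType} (N1 N2 : R -> R -> R) (J : R -> R -> R -> R -> Prop).
Hypothesis hJ : fixed_face N1 N2 J.
Implicit Types (a b d l s u w : R).

Let n1 : planar_norm N1. Proof. by case: hJ. Qed.
Let n2 : planar_norm N2. Proof. by case: hJ. Qed.
Let f1 := fixed_face_flat1 hJ.
Let f2 := fixed_face_flat2 hJ.

Lemma face_extension_pos : exists2 e, 0 < e & forall d l, 0 <= d -> d <= e ->
  0 < l -> N1 (l * (1 + d)) l = 1 -> J (l * (1 + d)) l (l * (1 + d)) l.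
Proof.
have hJn := fixed_face_neg hJ.
have ge1 (N : R -> R -> R) s : planar_norm N ->
    (forall s, -1 <= s -> s <= 1 -> N s 1 = 1) -> 1 <= N s 1.
  by move=> n f; have := flat_ge n f s 1.
have ext s : N2 s 1 = 1 -> N1 s 1 = 1.
  move=> /(fixed_face_extend (fixed_face_sym hJ)).
  by move=> /(fixed_face_sphere hJ)[].
have lt_ext s : 1 < N1 s 1 -> 1 < N2 s 1.
  move=> h; rewrite lt_neqAle ge1// andbT eq_sym; apply/eqP => /ext; lra.
have [b [b1 Nb right]] := flat_face_end n1 f1.
have [lt1b|] := ltP 1 b.
  exists (b - 1); first by lra.
  move=> d l d0 db l0 Nl.
  have Nd : N1 (1 + d) 1 = 1.
    apply/eqP; rewrite eq_le ge1// andbT -[X in _ <= X]Nb.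
    by apply: (flat_mono n1 f1); lra.
  have l1 : l = 1.
    move: Nl; rewrite -{2}(mulr1 l) (norm_scale_ge0 n1 _ _ (ltW l0)) Nd.
    by rewrite mulr1.
  by rewrite l1 mul1r; exact: (fixed_face_extend hJ).
move=> bl1; have {b1 bl1} b_1 : b = 1 by lra.
subst b.
have rflat s : -1 <= s -> s <= 1 -> N1 (- s) 1 = 1.
  by move=> s1 s2; apply: f1; lra.
have [a [a1 Na left]] := flat_face_end (planar_norm_reflect n1) rflat.
(* Half the length of the maximal face from [(-a, 1)] to [(1, 1)]: in the basis [(k, 0)],
   [(1 - k, 1)] its ends become [(-1, 1)] and [(1, 1)]. *)
pose k := (1 + a) / 2.
have k0 : 0 < k by rewrite divr_gt0//; lra.
have det : k * 1 - 0 * (1 - k) != 0.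
  by rewrite mul0r subr0 mulr1 gt_eqF.
have in_face s : -1 <= s -> s <= 1 ->
    N1 (s * k + 1 * (1 - k)) (s * 0 + 1 * 1) = 1.
  move=> s1 s2; rewrite mulr0 add0r !mul1r; set r := _ + _.
  have ra : - a <= r.
    have : 0 <= (s + 1) * k by rewrite mulr_ge0//; lra.
    by rewrite /r /k; lra.
  have r1 : r <= 1.
    have : 0 <= (1 - s) * k by rewrite mulr_ge0//; lra.
    by rewrite /r; lra.
  apply/eqP; rewrite eq_le ge1// andbT.
  have [r0|r0] := leP 0 r; first by rewrite -[X in _ <= X]Nb (flat_mono n1 f1).
  by rewrite -[X in _ <= X]Na (flat_monoN n1 f1)//; lra.
have hJ' : fixed_face
    (fun a b => N1 (a * k + b * (1 - k)) (a * 0 + b * 1))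
    (fun a b => N2 (a * k + b * (1 - k)) (a * 0 + b * 1))
    (fun a b c d => J (a * k + b * (1 - k)) (a * 0 + b * 1)
                      (c * k + d * (1 - k)) (c * 0 + d * 1)).
  split; [exact: planar_norm_basis|exact: planar_norm_basis| |].
    by apply: planar_isom_basis => //; case: hJ.
  move=> s s1 s2; have := in_face s s1 s2; rewrite mulr0 add0r mulr1 => h.
  split; first exact: (fixed_face_extend hJ).
  have := fixed_face_extend hJn h.
  rewrite (_ : - s * k + -1 * (1 - k) = - (s * k + 1 * (1 - k))); last by ring.
  by rewrite mulr0 add0r mulr1.
have out_right s : 1 < s -> 1 < N1 (s * k + 1 * (1 - k)) (s * 0 + 1 * 1).
  move=> s1; rewrite mulr0 add0r !mul1r; apply: right.
  have : 0 < (s - 1) * k by rewrite mulr_gt0//; lra.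
  lra.
have out_left s : s < -1 -> 1 < N1 (s * k + 1 * (1 - k)) (s * 0 + 1 * 1).
  move=> s1; rewrite mulr0 add0r !mul1r -[X in N1 X]opprK; apply: left.
  have : 0 < (- 1 - s) * k by rewrite mulr_gt0//; lra.
  by rewrite /k; lra.
have sharp1 := sharp_face_ends (planar_norm_basis det n1) out_right out_left.
have sharp2 : sharp_face
    (fun a b => N2 (a * k + b * (1 - k)) (a * 0 + b * 1)).
  apply: sharp_face_ends; first exact: planar_norm_basis.
    by move=> s /out_right; rewrite mulr0 add0r mulr1; exact: lt_ext.
  by move=> s /out_left; rewrite mulr0 add0r mulr1; exact: lt_ext.
have [w0 /andP[w00 w01] arc] := sharp_face_arc hJ' sharp1 sharp2.
(* For [d <= 1 - w0] the norm of [(1 + d, 1)] is at most [2 - w0], and [w0 * (2 - w0) < 1]; hence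
   the sphere point in this direction is higher than [w0], on the fixed arc. *)
exists (1 - w0); first by lra.
move=> d l d0 dw l0 Nl; have [d_0|dn0] := eqVneq d 0.
  have l1 : l = 1.
    move: Nl; rewrite d_0 addr0 -{2}(mulr1 l) (norm_scale_ge0 n1 _ _ (ltW l0)).
    by rewrite Nb mulr1.
  by rewrite d_0 l1 addr0 mul1r; exact: (fixed_face_extend hJ).
have dp : 0 < d by rewrite lt_neqAle eq_sym dn0.
have lE : l * N1 (1 + d) 1 = 1.
  by rewrite -(norm_scale_ge0 n1 _ _ (ltW l0)) mulr1.
have N_gt : 1 < N1 (1 + d) 1 by apply: right; lra.
have N_le : N1 (1 + d) 1 <= 1 + d.
  have := norm_lip n1 (1 + d) 1 1 1.
  rewrite subrr (_ : 1 + d - 1 = d); last by ring.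
  rewrite Nb (norm_hor n1 d) (gtr0_norm dp).
  have : d * N1 1 0 <= d * 1 by rewrite ler_pM2l// (flat_hor_le1 n1 f1).
  lra.
have l1 : l < 1.
  have : 0 < l * (N1 (1 + d) 1 - 1) by rewrite mulr_gt0// subr_gt0.
  lra.
have w0l : w0 < l.
  rewrite ltNge; apply/negP => lw0.
  have h1 : l * N1 (1 + d) 1 <= w0 * (1 + (1 - w0)).
    by apply: ler_pM => //; lra.
  have : 0 < (1 - w0) * (1 - w0) by rewrite mulr_gt0//; lra.
  lra.
have e1 : l * (1 + d) = l * (1 + d / k) * k + l * (1 - k).
  by field; rewrite gt_eqF.
have e2 : l = l * (1 + d / k) * 0 + l * 1 by ring.
have := arc (l * (1 + d / k)) l; rewrite -e1 -e2; apply => //.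
apply: mulr_ge0; first exact: ltW.
by apply: addr_ge0 => //; apply: divr_ge0 => //; exact: ltW.
Qed.

End FaceExtension.

Lemma face_extension (R : realType) (N1 N2 : R -> R -> R) J :
  fixed_face N1 N2 J -> exists2 e, 0 < e &
  forall d, 0 <= d -> d <= e -> fixed_dir N1 J (1 + d) 1.
Proof.
move=> hJ; have [e e0 h] := face_extension_pos hJ.
have [e' e'0 h'] := face_extension_pos (fixed_face_neg hJ).
have [n1 _ _ _] := hJ.
exists (Num.min e e'); first by rewrite lt_min e0.
move=> d d0; rewrite le_min => /andP[de de'] l; rewrite mulr1 => Nl.
have [l0|l0|l0] := ltgtP l 0.
- have := h' d (- l) d0 de'; rewrite !mulNr !opprK (normN n1); apply => //.
  by rewrite oppr_gt0.
- exact: h.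
- by move: Nl; rewrite l0 mul0r (norm00 n1) => /esym/eqP; rewrite oner_eq0.
Qed.

(** * Segments of the sphere in arbitrary position *)

Lemma norm_normalized (R : realType) (N : R -> R -> R) (t : R) :
  planar_norm N -> N (t / N t 1) (N t 1)^-1 = 1.
Proof.
move=> n; have k0 := norm_gt0 n t (@ltr01 R).
have -> : N (t / N t 1) (N t 1)^-1 =
    N ((N t 1)^-1 * t) ((N t 1)^-1 * 1) by congr N; ring.
by rewrite (norm_scale_ge0 n) ?invr_ge0 ?ltW// mulVf// gt_eqF.
Qed.

Section Segment.
Context {R : realType} (N : R -> R -> R) (n : planar_norm N) (t0 t1 : R).
Hypothesis t01 : t0 < t1.
Hypothesis mid :
  N (t0 / N t0 1 + t1 / N t1 1) ((N t0 1)^-1 + (N t1 1)^-1) = 2.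

(** The hypothesis [mid] is equality in the triangle inequality for the unit vectors over [t0] and
    [t1], so that the norm is linear between them and their chord lies on the sphere. *)
Lemma segment_norm k l : 0 <= k -> 0 <= l ->
  N (k * (t0 / N t0 1) + l * (t1 / N t1 1))
    (k * (N t0 1)^-1 + l * (N t1 1)^-1) = k + l.
Proof.
have := @norm_linear_on _ _ n (t0 / N t0 1) (N t0 1)^-1 (t1 / N t1 1)
  (N t1 1)^-1 1 1 ltr01 ltr01.
rewrite !mul1r !norm_normalized// => /(_ mid) lin k0 l0.
by rewrite lin// !mulr1.
Qed.

Lemma segment_point k l : 0 <= k -> 0 <= l -> k + l = 1 -> exists t,
  [/\ t0 <= t, t <= t1, k * (t0 / N t0 1) + l * (t1 / N t1 1) = t / N t 1 &
      k * (N t0 1)^-1 + l * (N t1 1)^-1 = (N t 1)^-1].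
Proof.
move=> k0 l0 kl.
have q0 : 0 < (N t0 1)^-1 by rewrite invr_gt0 norm_gt0.
have p0 : 0 < (N t1 1)^-1 by rewrite invr_gt0 norm_gt0.
have := segment_norm k0 l0; rewrite kl.
set a := _ + _; set b := _ + _ => Nab.
have kq : 0 <= k * (N t0 1)^-1 by rewrite mulr_ge0// ltW.
have lp : 0 <= l * (N t1 1)^-1 by rewrite mulr_ge0// ltW.
have b0 : 0 < b.
  rewrite lt_neqAle addr_ge0// andbT eq_sym; apply/eqP => b_0.
  have : k * (N t0 1)^-1 = 0 by rewrite /b in b_0; lra.
  have : l * (N t1 1)^-1 = 0 by rewrite /b in b_0; lra.
  move=> /eqP; rewrite mulf_eq0 (gt_eqF p0) orbF => /eqP l_0.
  move=> /eqP; rewrite mulf_eq0 (gt_eqF q0) orbF => /eqP k_0.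
  by move: kl; rewrite l_0 k_0; lra.
have bn : b != 0 by rewrite gt_eqF.
have Nt : N (a / b) 1 = b^-1.
  have -> : N (a / b) 1 = N (b^-1 * a) (b^-1 * b).
    by rewrite mulVf// (mulrC a).
  by rewrite (norm_scale_ge0 n) ?Nab ?mulr1// invr_ge0 ltW.
exists (a / b); rewrite Nt invrK divfK//; split=> //.
  rewrite ler_pdivlMr// /a /b.
  have : 0 <= (t1 - t0) * (l * (N t1 1)^-1) by rewrite mulr_ge0// subr_ge0 ltW.
  lra.
rewrite ler_pdivrMr// /a /b.
have : 0 <= (t1 - t0) * (k * (N t0 1)^-1) by rewrite mulr_ge0// subr_ge0 ltW.
lra.
Qed.

Lemma point_segment t : t0 <= t -> t <= t1 -> exists k l,
  [/\ 0 <= k, 0 <= l, k + l = 1,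
      k * (t0 / N t0 1) + l * (t1 / N t1 1) = t / N t 1 &
      k * (N t0 1)^-1 + l * (N t1 1)^-1 = (N t 1)^-1].
Proof.
move=> t0t tt1.
have k0 := norm_gt0 n t0 (@ltr01 R); have k1 := norm_gt0 n t1 (@ltr01 R).
have kt := norm_gt0 n t (@ltr01 R).
have D0 : 0 < t1 - t0 by rewrite subr_gt0.
pose k := (t1 - t) * N t0 1 / ((t1 - t0) * N t 1).
pose l := (t - t0) * N t1 1 / ((t1 - t0) * N t 1).
have den : 0 <= (t1 - t0) * N t 1 by rewrite mulr_ge0// ltW.
have k_0 : 0 <= k.
  by apply: divr_ge0 => //; apply: mulr_ge0; [lra|exact: ltW].
have l_0 : 0 <= l.
  by apply: divr_ge0 => //; apply: mulr_ge0; [lra|exact: ltW].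
have e1 : k * (t0 / N t0 1) + l * (t1 / N t1 1) = t / N t 1.
  by rewrite /k /l; field; rewrite !gt_eqF.
have e2 : k * (N t0 1)^-1 + l * (N t1 1)^-1 = (N t 1)^-1.
  by rewrite /k /l; field; rewrite !gt_eqF.
exists k, l; split=> //.
by rewrite -(segment_norm k_0 l_0) e1 e2 norm_normalized.
Qed.

End Segment.

Lemma segment_extension (R : realType) (N1 N2 : R -> R -> R) J (t0 t1 : R) :
  planar_norm N1 -> planar_norm N2 -> planar_isom N1 N2 J -> t0 < t1 ->
  (forall t, t0 <= t -> t <= t1 -> fixed_dir N1 J t 1) ->
  N1 (t0 / N1 t0 1 + t1 / N1 t1 1) ((N1 t0 1)^-1 + (N1 t1 1)^-1) = 2 ->
  exists2 e, 0 < e &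
  forall t, t1 <= t -> t <= t1 + e -> fixed_dir N1 J t 1.
Proof.
move=> n1 n2 iso t01 fixt mid.
have k00 := norm_gt0 n1 t0 (@ltr01 R).
have k10 := norm_gt0 n1 t1 (@ltr01 R).
pose k0 := N1 t0 1; pose k1 := N1 t1 1.
rewrite -/k0 in k00; rewrite -/k1 in k10.
have k0n := gt_eqF k00; have k1n := gt_eqF k10.
pose p1 := t1 / k1; pose p2 := k1^-1; pose q1 := t0 / k0; pose q2 := k0^-1.
pose x1 := (p1 - q1) / 2; pose x2 := (p2 - q2) / 2.
pose y1 := (p1 + q1) / 2; pose y2 := (p2 + q2) / 2.
have det : x1 * y2 - x2 * y1 != 0.
  have -> : x1 * y2 - x2 * y1 = (t1 - t0) / (2 * k1 * k0).
    by rewrite /x1 /x2 /y1 /y2 /p1 /p2 /q1 /q2; field; rewrite k0n k1n.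
  by rewrite gt_eqF// divr_gt0 ?mulr_gt0//; lra.
have p20 : 0 < p2 by rewrite invr_gt0.
have q20 : 0 < q2 by rewrite invr_gt0.
have p1E : p1 = t1 * p2 by [].
have q1E : q1 = t0 * q2 by [].
have hJ : fixed_face
    (fun a b => N1 (a * x1 + b * y1) (a * x2 + b * y2))
    (fun a b => N2 (a * x1 + b * y1) (a * x2 + b * y2))
    (fun a b c d => J (a * x1 + b * y1) (a * x2 + b * y2)
                      (c * x1 + d * y1) (c * x2 + d * y2)).
  split; [exact: planar_norm_basis|exact: planar_norm_basis| |].
    exact: planar_isom_basis.
  move=> s s1 s2.
  pose a := (1 - s) / 2; pose b := (1 + s) / 2.
  have a0 : 0 <= a by rewrite divr_ge0//; lra.
  have b0 : 0 <= b by rewrite divr_ge0//; lra.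
  have e1 : s * x1 + 1 * y1 = a * q1 + b * p1 by rewrite /a /b /x1 /y1; field.
  have e2 : s * x2 + 1 * y2 = a * q2 + b * p2 by rewrite /a /b /x2 /y2; field.
  have e1' : - s * x1 + -1 * y1 = - (a * q1 + b * p1).
    by rewrite -e1; ring.
  have e2' : - s * x2 + -1 * y2 = - (a * q2 + b * p2).
    by rewrite -e2; ring.
  rewrite e1 e2 e1' e2'.
  have ab : a + b = 1 by rewrite /a /b; field.
  have [t [t0t tt1 -> ->]] := segment_point n1 t01 mid a0 b0 ab.
  have i0 : 0 <= (N1 t 1)^-1 by rewrite invr_ge0 norm_ge0.
  have ft := fixt t t0t tt1.
  split.
    have := ft (N1 t 1)^-1; rewrite mulr1 mulrC; apply.
    exact: norm_normalized.
  have := ft (- (N1 t 1)^-1); rewrite mulr1 mulNr mulrC (normN n1); apply.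
  exact: norm_normalized.
have [e e0 h] := face_extension hJ.
have D0 : 0 < t1 - t0 by lra.
(* Chosen so that [(2 + e) * cq <= e * k1]; with [k1 <= cp] this amounts to [d <= e] below. *)
pose e' := e * k1 * (t1 - t0) / ((2 + e) * k0).
exists e'; first by rewrite divr_gt0 ?mulr_gt0//; lra.
move=> t t1t te'.
(* The coefficients of [(t, 1) = cp * p - cq * q]. Since [p = x + y] and [q = y - x], the direction
   in the basis [x], [y] is [(1 + d, 1)] with [d = 2 * cq / (cp - cq)]. *)
pose cp := k1 * (t - t0) / (t1 - t0).
pose cq := k0 * (t - t1) / (t1 - t0).
have cp0 : 0 < cp by rewrite divr_gt0 ?mulr_gt0//; lra.
have cq0 : 0 <= cq by rewrite divr_ge0 ?mulr_ge0//; lra.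
have Dn := gt_eqF D0.
have cpq : (2 + e) * cq <= e * cp.
  have h1 : (2 + e) * cq <= e * k1.
    rewrite /cq mulrA ler_pdivrMr//.
    have : t - t1 <= e' by lra.
    by rewrite ler_pdivlMr ?mulr_gt0//; lra.
  have : k1 <= cp.
    by rewrite ler_pdivlMr// ler_pM2l//; lra.
  rewrite -(ler_pM2l e0); lra.
have ecq : 0 <= e * cq by rewrite mulr_ge0// ltW.
have m0 : 0 < cp - cq.
  rewrite -(ltr_pM2l e0) mulr0 mulrBr.
  have : 0 <= cq by [].
  rewrite le_eqVlt => /orP[/eqP c0|c0]; last by lra.
  by rewrite -c0 mulr0 subr0 mulr_gt0.
pose d := 2 * cq / (cp - cq).
have d0 : 0 <= d by apply: divr_ge0; [exact: mulr_ge0|exact: ltW].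
have de : d <= e by rewrite ler_pdivrMr//; lra.
have dE : (cp - cq) * d = 2 * cq by rewrite mulrC divfK// gt_eqF.
have tE : t = (cp - cq) * ((1 + d) * x1 + 1 * y1).
  transitivity ((cp - cq) * (x1 + y1) + (cp - cq) * d * x1); last by ring.
  rewrite dE /x1 /y1 /cp /cq /p1 /q1; field.
  by rewrite k0n k1n Dn.
have oneE : 1 = (cp - cq) * ((1 + d) * x2 + 1 * y2).
  transitivity ((cp - cq) * (x2 + y2) + (cp - cq) * d * x2); last by ring.
  rewrite dE /x2 /y2 /cp /cq /p2 /q2; field.
  by rewrite k0n k1n Dn.
move=> l Nl; have := h d d0 de (l * (cp - cq)).
have e1 : l * (cp - cq) * (1 + d) * x1 + l * (cp - cq) * 1 * y1 = l * t.
  by rewrite [in RHS]tE; ring.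
have e2 : l * (cp - cq) * (1 + d) * x2 + l * (cp - cq) * 1 * y2 = l * 1.
  transitivity (l * ((cp - cq) * ((1 + d) * x2 + 1 * y2))); first by ring.
  by rewrite -oneE.
by rewrite e1 e2; apply.
Qed.

(** * Continuation past the end of a strictly curved arc *)

(* Positive when [(c, d)] lies clockwise from [(a, b)]; on the upper half-plane
   this says [a / b < c / d]. *)
Definition turn (R : realType) (a b c d : R) : R := c * b - a * d.

Lemma turn_trans (R : realType) (a b c d e f : R) : 0 < b -> 0 < d -> 0 < f ->
  0 < turn a b c d -> 0 < turn c d e f -> 0 < turn a b e f.
Proof.
move=> b0 d0 f0 h1 h2; rewrite -(pmulr_rgt0 _ d0).
have -> : d * turn a b e f = f * turn a b c d + b * turn c d e f.
  by rewrite /turn; ring.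
by rewrite addr_gt0// mulr_gt0.
Qed.

Section Chords.
Context {R : realType} (N : R -> R -> R) (hN : planar_norm N).
Implicit Types (a b c d e f g h k l v w A B : R).

Definition linear_on_cone a b c d : Prop := forall k l, 0 <= k -> 0 <= l ->
  N (k * a + l * c) (k * b + l * d) = k * N a b + l * N c d.

Lemma linear_on_coneD a b c d e f g h : linear_on_cone a b c d ->
  0 < turn a b c d ->
  0 <= turn a b e f -> 0 <= turn e f c d ->
  0 <= turn a b g h -> 0 <= turn g h c d ->
  N (e + g) (f + h) = N e f + N g h.
Proof.
move=> lin D0 t1 t2 t3 t4; have Dn := gt_eqF D0.
have dec x y : 0 <= turn a b x y -> 0 <= turn x y c d -> exists k l,
    [/\ 0 <= k, 0 <= l, x = k * a + l * c & y = k * b + l * d].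
  move=> h1 h2.
  exists (turn x y c d / turn a b c d), (turn a b x y / turn a b c d).
  split; try by apply: divr_ge0 => //; exact: ltW.
    by move: Dn; rewrite /turn => Dn; field; rewrite Dn.
  by move: Dn; rewrite /turn => Dn; field; rewrite Dn.
have [k [l [k0 l0 -> ->]]] := dec e f t1 t2.
have [k' [l' [k'0 l'0 -> ->]]] := dec g h t3 t4.
rewrite !lin//.
have -> : N (k * a + l * c + (k' * a + l' * c))
    (k * b + l * d + (k' * b + l' * d)) =
    N ((k + k') * a + (l + l') * c) ((k + k') * b + (l + l') * d).
  by congr N; ring.
rewrite lin ?addr_ge0//; ring.
Qed.

(* Parallel chords, traversed in the same direction along a convex curve, lie
   on a common line. *)
Lemma chords_forward a b c d v w : N (a + v) (b + w) = N a b ->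
  N (c + v) (d + w) = N c d ->
  0 < turn a b v w -> 0 < turn c d v w -> 0 < turn (a + v) (b + w) c d ->
  linear_on_cone a b c d.
Proof.
move=> e1 e2 k1 k2 D12.
set A := N a b in e1; set B := N c d in e2.
pose D := turn a b c d.
have DE : turn (a + v) (b + w) c d = D - turn c d v w.
  by rewrite /D /turn; ring.
rewrite DE in D12.
set p := turn a b v w in k1; set q := turn c d v w in k2 D12 DE.
(* Here [(a + v, b + w)] is between the two starting points, and [(c, d)] is between the two end
   points. The resulting triangle inequalities say [q * A <= p * B] and [p * B <= q * A], so the
   first one is an equality. *)
have h1 : D * A <= (D - q) * A + p * B.
  have := @norm_comb_eq _ _ hN a b c d (D - q) p (D * (a + v)) (D * (b + w))
    (ltW D12) (ltW k1) ltac:(rewrite /D /p /q /turn; ring)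
    ltac:(rewrite /D /p /q /turn; ring).
  by rewrite (norm_scale_ge0 hN (a + v)) ?e1//; lra.
have h2 : (D + p - q) * B <= q * A + (D - q) * B.
  have := @norm_comb_eq _ _ hN (a + v) (b + w) (c + v) (d + w) q (D - q)
    ((D + p - q) * c) ((D + p - q) * d)
    (ltW k2) (ltW D12) ltac:(rewrite /D /p /q /turn; ring)
    ltac:(rewrite /D /p /q /turn; ring).
  by rewrite e1 e2 (norm_scale_ge0 hN c)//; lra.
apply: (norm_linear_on hN D12 k1); rewrite -/A -/B.
transitivity (N (D * (a + v)) (D * (b + w))).
  by congr N; rewrite /D /p /q /turn; ring.
by rewrite (norm_scale_ge0 hN) ?e1; lra.
Qed.

(** The signs and the identity [D * v = k * c - q * a] put the chord vector in the open cone of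
    [(a, b)] and [(c, d)]. As these are close together compared with their norm, adding such a
    vector cannot preserve the norm. *)
Lemma chords_opposite a b c d v w : N (a + v) (b + w) = N a b ->
  0 < N a b -> 0 < N v w -> N v w + N (a - c) (b - d) <= N a b ->
  0 < turn a b v w -> turn c d v w < 0 -> 0 < turn a b c d -> False.
Proof.
move=> e1 A0 V0 small; set A := N a b in e1 A0 small.
set k := turn a b v w; set q := turn c d v w => k0 q0.
set D := turn a b c d => D0.
have P0 := norm_ge0 hN (a - c) (b - d).
set P := N (a - c) (b - d) in P0 small.
set V := N v w in V0 small.
pose E := D + k - q.
have E0 : 0 < E by rewrite /E; lra.
have h1 : (k - q) * A <= E * V + k * P.
  have := @norm_comb_eq _ _ hN v w (a - c) (b - d) E k
    ((k - q) * (a + v)) ((k - q) * (b + w)) (ltW E0) (ltW k0)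
    ltac:(rewrite /E /D /k /q /turn; ring)
    ltac:(rewrite /E /D /k /q /turn; ring).
  by rewrite (norm_scale_ge0 hN (a + v)) ?e1 -/V -/P//; lra.
have h2 : k - q <= E -> E * A <= (E - (k - q)) * A + k * P.
  move=> kE.
  have := @norm_comb_eq _ _ hN (a + v) (b + w) (a - c) (b - d) (E - (k - q)) k
    (E * a) (E * b) ltac:(lra) (ltW k0)
    ltac:(rewrite /E /D /k /q /turn; ring)
    ltac:(rewrite /E /D /k /q /turn; ring).
  by rewrite (norm_scale_ge0 hN a b (ltW E0)) e1 -/A -/P; lra.
have kP : k * P <= k * (A - V) by rewrite ler_pM2l//; lra.
have kV : 0 < k * V by rewrite mulr_gt0.
have qA : 0 < - q * A by rewrite mulr_gt0//; lra.
have [kE|Ek] := leP (k - q) E.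
  by have := h2 kE; lra.
have EV : E * V < (k - q) * V by rewrite ltr_pM2r.
have qP : 0 <= - q * P by rewrite mulr_ge0//; lra.
have : (k - q) * (V + P) <= (k - q) * A by rewrite ler_pM2l//; lra.
lra.
Qed.

Lemma chord_turn_neq0 a b v w : 0 < b -> N (a + v) (b + w) = N a b ->
  0 < N v w -> N v w <= N a b -> turn a b v w != 0.
Proof.
move=> b0 e V0 VA; apply/eqP => t0.
pose m := w / b.
have mb : m * b = w by rewrite divfK// gt_eqF.
have ma : m * a = v.
  have bn : b != 0 by rewrite gt_eqF.
  by apply: (mulIf bn); rewrite -mulrA (mulrC a) mulrA mb; move: t0;
     rewrite /turn; lra.
move: V0 VA; rewrite -ma -mb (norm_scale hN) => V0 VA.
have A0 : 0 < N a b by apply: norm_gt0.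
have m1 : `|m| <= 1 by rewrite -(ler_pM2r A0) mul1r.
have : `|1 + m| * N a b = 1 * N a b.
  rewrite -(norm_scale hN) mul1r -e -ma -mb; congr N; ring.
have An : N a b != 0 by rewrite gt_eqF.
move=> /(mulIf An); have := ler_norm (- m); rewrite normrN => mm.
rewrite ger0_norm; last by lra.
move=> m0; have {}m0 : m = 0 by lra.
by move: V0; rewrite m0 normr0 mul0r ltxx.
Qed.

(** The two turns are nonzero. If both are positive, the chords run forward from their starting
    points; if both are negative, the reversed chords do so from their end points; mixed signs are
    excluded by [chords_opposite]. *)
Lemma parallel_chords a b c d v w :
  N (a + v) (b + w) = N a b -> N (c + v) (d + w) = N c d ->
  0 < b -> 0 < d -> 0 < b + w -> 0 < d + w -> 0 < N v w ->
  N v w + N (a - c) (b - d) <= N a b ->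
  N v w + N (a - c) (b - d) <= N c d ->
  0 < turn a b c d -> 0 < turn (a + v) (b + w) c d ->
  0 < turn a b (c + v) (d + w) -> 0 < turn (a + v) (b + w) (c + v) (d + w) ->
  linear_on_cone a b c d \/
  linear_on_cone (a + v) (b + w) (c + v) (d + w).
Proof.
move=> e1 e2 b0 d0 bw0 dw0 V0 sA sB D1 D2 D3 D4.
have P0 := norm_ge0 hN (a - c) (b - d).
have A0 : 0 < N a b by apply: norm_gt0.
have VN : N (- v) (- w) = N v w by exact: normN.
have e1' : N (a + v + - v) (b + w + - w) = N (a + v) (b + w).
  by rewrite !addrK.
have e2' : N (c + v + - v) (d + w + - w) = N (c + v) (d + w).
  by rewrite !addrK.
have t1 : turn (a + v) (b + w) (- v) (- w) = - turn a b v w.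
  by rewrite /turn; ring.
have t2 : turn (c + v) (d + w) (- v) (- w) = - turn c d v w.
  by rewrite /turn; ring.
have diff : N (a + v - (c + v)) (b + w - (d + w)) = N (a - c) (b - d).
  by congr N; ring.
have n1 := @chord_turn_neq0 a b v w b0 e1 V0 ltac:(lra).
have n2 := @chord_turn_neq0 c d v w d0 e2 V0 ltac:(lra).
have [k1|k1|k1] := ltgtP (turn a b v w) 0; last by rewrite k1 eqxx in n1.
- have [k2|k2|k2] := ltgtP (turn c d v w) 0; last by rewrite k2 eqxx in n2.
    right; apply: (@chords_forward _ _ _ _ (- v) (- w)) => //.
    + by rewrite t1; lra.
    + by rewrite t2; lra.
    + by rewrite !addrK.
  exfalso; apply: (@chords_opposite (a + v) (b + w) (c + v) (d + w)
    (- v) (- w)) => //; rewrite ?VN ?e1 ?diff ?t1 ?t2 //; lra.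
- have [k2|k2|k2] := ltgtP (turn c d v w) 0; last by rewrite k2 eqxx in n2.
    by exfalso; apply: (@chords_opposite a b c d v w).
  by left; apply: (@chords_forward _ _ _ _ v w).
Qed.

End Chords.

(** * Small displacements and nearby points of the sphere *)

Section NearOrigin.
Context {R : realType}.
Implicit Types (P Q : R -> R -> Prop) (N : R -> R -> R).

Definition near_origin P : Prop :=
  exists2 r : R, 0 < r & forall d e, `|d| < r -> `|e| < r -> P d e.

Lemma near_origin_and P Q : near_origin P -> near_origin Q ->
  near_origin (fun d e => P d e /\ Q d e).
Proof.
move=> [r r0 h] [s s0 h']; exists (Num.min r s); first by rewrite lt_min r0.
by move=> d e; rewrite !lt_min => /andP[d1 d2] /andP[e1 e2]; split;
   [apply: h|apply: h'].
Qed.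

Lemma near_origin_norm N (x : R) : planar_norm N -> 0 < x ->
  near_origin (fun d e => N d e < x).
Proof.
move=> n x0; pose K := N 1 0 + N 0 1.
have K0 : 0 < K by rewrite /K ltr_wpDr ?norm_ge0// norm10_gt0.
exists (x / K); first by rewrite divr_gt0.
move=> d e d1 e1; apply: le_lt_trans (norm_le_coord n d e) _.
have h1 : `|d| * N 1 0 < x / K * N 1 0 by rewrite ltr_pM2r// norm10_gt0.
have h2 : `|e| * N 0 1 <= x / K * N 0 1 by rewrite ler_wpM2r ?norm_ge0// ltW.
have : x / K * (N 1 0 + N 0 1) = x by rewrite divfK// gt_eqF.
lra.
Qed.

Lemma near_origin_turn_gt0 (a b c d : R) : 0 < turn a b c d ->
  near_origin (fun x y => 0 < turn a b (c + x) (d + y)).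
Proof.
move=> t0; pose K := `|a| + `|b| + 1.
have a0 := normr_ge0 a; have b0 := normr_ge0 b.
have K0 : 0 < K by rewrite /K; lra.
exists (turn a b c d / K); first by rewrite divr_gt0.
set r := _ / K => x y xr yr.
have rK : r * (`|a| + `|b| + 1) = turn a b c d by rewrite divfK// gt_eqF.
have r0 : 0 < r by rewrite divr_gt0.
have h1 : `|x * b| <= r * `|b| by rewrite normrM ler_wpM2r// ltW.
have h2 : `|a * y| <= r * `|a| by rewrite normrM mulrC ler_wpM2r// ltW.
have -> : turn a b (c + x) (d + y) = turn a b c d + x * b - a * y.
  by rewrite /turn; ring.
by have := ler_norm (- (x * b)); have := ler_norm (a * y); rewrite normrN; lra.
Qed.

Lemma near_origin_turn_gt0l (a b c d : R) : 0 < turn c d a b ->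
  near_origin (fun x y => 0 < turn (c + x) (d + y) a b).
Proof.
have flip (x y : R) : turn x y a b = turn (- a) (- b) x y.
  by rewrite /turn; ring.
rewrite flip => /near_origin_turn_gt0[r r0 h].
by exists r => // x y xr yr; rewrite flip; exact: h.
Qed.

Lemma near_origin_ball N P : planar_norm N -> near_origin P ->
  exists2 r, 0 < r & forall d e, N d e < r -> P d e.
Proof.
move=> n [r r0 h]; have [m m0 hm] := norm_ge_coord n.
exists (m * r); first by rewrite mulr_gt0.
move=> d e Nr; have [hd he] := hm d e.
by apply: h; rewrite -(ltr_pM2l m0); lra.
Qed.

Lemma near_origin_sphere N P (t0 : R) : planar_norm N -> near_origin P ->
  exists2 r, 0 < r & forall t, `|t - t0| < r ->
    P (t / N t 1 - t0 / N t0 1) ((N t 1)^-1 - (N t0 1)^-1).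
Proof.
move=> n [r r0 h].
have k0 : N t0 1 != 0 by rewrite gt_eqF// norm_gt0.
have c1 : (fun t => (N t 1)^-1) x @[x --> t0] --> (N t0 1)^-1.
  by apply: cvgV => //; exact: (continuous_norm_hor n).
have c2 : (fun t => t / N t 1) x @[x --> t0] --> t0 / N t0 1.
  by apply: cvgM => //; exact: cvg_id.
have [e /= e0 he] : \forall x \near t0,
    `|x / N x 1 - t0 / N t0 1| < r /\ `|(N x 1)^-1 - (N t0 1)^-1| < r.
  move/cvgrPdist_lt : c1 => /(_ _ r0) c1.
  move/cvgrPdist_lt : c2 => /(_ _ r0) c2.
  near=> x; split; rewrite distrC.
  - by near: x; exact: c2.
  - by near: x; exact: c1.
exists e => // t te.
have /he[] : ball_ Num.norm t0 e t by rewrite /ball_ /= distrC.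
exact: h.
Unshelve. all: by end_near.
Qed.

End NearOrigin.

Lemma turn_dir (R : realType) (a b c d : R) : 0 < b -> 0 < d ->
  (0 < turn a b c d) = (a / b < c / d).
Proof.
move=> b0 d0; rewrite ltr_pdivrMr// mulrAC ltr_pdivlMr// /turn subr_gt0.
by [].
Qed.

(** Only the upper of the two antipodal points: antipodes are handled by applying the same results
    to the conjugate of [J] by negation. *)
Definition fixed_ray (R : realType) (N : R -> R -> R)
    (J : R -> R -> R -> R -> Prop) (t : R) : Prop :=
  forall l, 0 < l -> N (l * t) l = 1 -> J (l * t) l (l * t) l.

Lemma fixed_dir_ray (R : realType) (N : R -> R -> R) J (t : R) :
  fixed_dir N J t 1 -> fixed_ray N J t.
Proof. by move=> h l _; have := h l; rewrite mulr1. Qed.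

Lemma fixed_ray_dir (R : realType) (N : R -> R -> R) J (t : R) :
  planar_norm N -> fixed_ray N J t ->
  fixed_ray N (fun a b c d => J (- a) (- b) (- c) (- d)) t ->
  fixed_dir N J t 1.
Proof.
move=> n h h' l; rewrite mulr1 => Nl; have [l0|l0|l0] := ltgtP l 0.
- by have := h' (- l); rewrite !mulNr !opprK (normN n) oppr_gt0; exact.
- exact: h.
- by move: Nl; rewrite l0 mul0r (norm00 n) => /esym/eqP; rewrite oner_eq0.
Qed.

Lemma fixed_ray_point (R : realType) (N : R -> R -> R) J (t : R) :
  planar_norm N ->
  fixed_ray N J t <-> J (t / N t 1) (N t 1)^-1 (t / N t 1) (N t 1)^-1.
Proof.
move=> n; have k0 := norm_gt0 n t (@ltr01 R).
split=> [h|h l l0 Nl].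
  rewrite (mulrC t); apply: h; first by rewrite invr_gt0.
  by rewrite mulrC norm_normalized.
have kE : l * N t 1 = 1 by rewrite -(norm_scale_ge0 n _ _ (ltW l0)) mulr1.
have kn : N t 1 != 0 by rewrite gt_eqF.
have -> : l = (N t 1)^-1 by apply: (mulIf kn); rewrite kE mulVf.
by rewrite (mulrC _ t).
Qed.

Section CornerExtension.
Context {R : realType} (N1 N2 : R -> R -> R) (J : R -> R -> R -> R -> Prop).
Hypotheses (n1 : planar_norm N1) (n2 : planar_norm N2).
Hypothesis iso : planar_isom N1 N2 J.
Implicit Types (a b d l s t u w : R).

Lemma fixed_ray_norm t a b : 0 < b -> a = t * b -> fixed_ray N1 J t ->
  N1 a b = N2 a b.
Proof.
move=> b0 aE fixt.
have N0 : 0 < N1 a b := norm_gt0 n1 a b0.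
have [i iE] : exists i, i = (N1 a b)^-1 by exists (N1 a b)^-1.
have lt : i * b * t = i * a by rewrite aE; ring.
have i0 : 0 <= i by rewrite iE invr_ge0 ltW.
have ib0 : 0 < i * b by rewrite mulr_gt0// iE invr_gt0.
have := fixt (i * b) ib0.
rewrite lt (norm_scale_ge0 n1 _ _ i0) {1}iE mulVf ?gt_eqF//.
move=> /(_ erefl); case: iso => h _ _ _ /h[_].
rewrite (norm_scale_ge0 n2 _ _ i0) => e.
have in0 : i != 0 by rewrite iE invr_eq0 gt_eqF.
by apply: (mulfI in0); rewrite e iE mulVf// gt_eqF.
Qed.

(** If the image [y] differed from [x], its difference [(v, w)] would give parallel chords at the
    sums of [x] with the points over [s0] and [s2]. The norm would then be linear on a cone
    containing the directions [s1] and [s2], against the strict inequality for their sum. *)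
Lemma corner_step (X Y : R -> R) t0 t1 s0 s1 s2 x1 x2 y1 y2 :
  (forall t, X t = t * Y t) -> (forall t, 0 < Y t) ->
  (forall t, N1 (X t) (Y t) = 1) ->
  (forall t, t0 <= t -> t <= t1 -> fixed_ray N1 J t) ->
  (forall t, t0 <= t -> t <= t1 -> J (- X t) (- Y t) (- X t) (- Y t)) ->
  t0 <= s0 -> s0 < s1 -> s1 < s2 -> s2 < t1 ->
  N1 (X s0 - X t1) (Y s0 - Y t1) < 8^-1 ->
  N1 (X s2 - X t1) (Y s2 - Y t1) < 8^-1 ->
  N1 (X s1 + X s2) (Y s1 + Y s2) < 2 ->
  J x1 x2 y1 y2 -> 0 < x2 -> 0 < y2 ->
  N1 (x1 - X t1) (x2 - Y t1) < 8^-1 -> N1 (y1 - X t1) (y2 - Y t1) < 8^-1 ->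
  0 < turn (X s0) (Y s0) y1 y2 -> 0 < turn (X s2) (Y s2) y1 y2 ->
  0 < turn (X s2) (Y s2) x1 x2 ->
  0 < turn (X s0 + x1) (Y s0 + x2) (X s1) (Y s1) ->
  0 < turn (X s0 + y1) (Y s0 + y2) (X s1) (Y s1) ->
  0 < turn (X s0 + y1) (Y s0 + y2) (X t1) (Y t1) ->
  0 < turn (X s2 + y1) (Y s2 + y2) (X t1) (Y t1) ->
  y1 = x1 /\ y2 = x2.
Proof.
move=> XY Y0 NXY fixt Jopp t0s0 s0s1 s1s2 s2t1 Ns0 Ns2 gap j x20 y20 xp yp
  yq1 yq2 xq2 xm ym ys1 ys2.
have half1 : 1 / 2 <= 1 :> R by lra.
have s0t1 : s0 < t1 by lra.
have t0s2 : t0 <= s2 by lra.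
have dist a b a' b' c d c' d' : J a b c d -> J a' b' c' d' ->
    N1 (a - a') (b - b') = N2 (c - c') (d - d').
  by case: iso => _ _ _; apply.
have turnXY s t : s < t -> 0 < turn (X s) (Y s) (X t) (Y t).
  move=> st; have -> : turn (X s) (Y s) (X t) (Y t) = (t - s) * (Y s * Y t).
    by rewrite /turn !XY; ring.
  by rewrite mulr_gt0 ?subr_gt0// mulr_gt0.
have [/andP[/eqP e1 /eqP e2]|ne] := boolP ((y1 == x1) && (y2 == x2)).
  by [].
pose v := y1 - x1; pose w := y2 - x2.
have V0 : 0 < N1 v w.
  rewrite lt_neqAle norm_ge0// andbT eq_sym; apply/eqP => /(norm_eq0 n1)[e1 e2].
  by move: ne; rewrite -subr_eq0 -/v e1 eqxx -subr_eq0 -/w e2 eqxx.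
(* The fixed antipode of the point over [s] turns the sum with [x] into a distance, preserved by
   [J]; the sum with [y] lies over the fixed arc, where [N2] can be replaced by [N1]. *)
have sums s : t0 <= s -> s < t1 ->
    0 < turn (X s) (Y s) y1 y2 -> 0 < turn (X s + y1) (Y s + y2) (X t1) (Y t1) ->
    N1 (X s + x1 + v) (Y s + x2 + w) = N1 (X s + x1) (Y s + x2).
  move=> t0s st1 h1 h2.
  have -> : N1 (X s + x1 + v) (Y s + x2 + w) = N1 (X s + y1) (Y s + y2).
    by congr N1; rewrite /v /w; ring.
  have js := Jopp s t0s (ltW st1).
  have := dist _ _ _ _ _ _ _ _ j js; rewrite !opprK.
  rewrite (addrC x1) (addrC x2) (addrC y1) (addrC y2) => ->.
  have b0 : 0 < Y s + y2 by rewrite addr_gt0.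
  pose t' := (X s + y1) / (Y s + y2).
  apply: (@fixed_ray_norm t') => //; first by rewrite divfK// gt_eqF.
  apply: fixt.
    apply: (le_trans t0s); rewrite ler_pdivlMr//.
    have : 0 < turn (X s) (Y s) y1 y2 / Y s by rewrite divr_gt0.
    have -> : turn (X s) (Y s) y1 y2 / Y s = y1 - s * y2.
      by rewrite /turn XY; field; rewrite gt_eqF.
    by rewrite XY; lra.
  rewrite ler_pdivrMr//.
  have : 0 < turn (X s + y1) (Y s + y2) (X t1) (Y t1) / (Y t1) by rewrite divr_gt0.
  have -> : turn (X s + y1) (Y s + y2) (X t1) (Y t1) / (Y t1) =
      t1 * (Y s + y2) - (X s + y1).
    by rewrite /turn XY; field; rewrite gt_eqF.
  lra.
have e1 := sums s0 t0s0 s0t1 yq1 ys1.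
have e2 := sums s2 t0s2 s2t1 yq2 ys2.
have shift s : (X s + x1 + v = X s + y1) * (Y s + x2 + w = Y s + y2).
  by split; rewrite /v /w; ring.
have turn_sum2 s a b : 0 < turn (X s) (Y s) a b ->
    0 < turn (X s) (Y s) (X s + a) (Y s + b).
  by rewrite /turn; lra.
have b0 s : 0 < Y s + x2 by rewrite addr_gt0.
have d0 s : 0 < Y s + y2 by rewrite addr_gt0.
have chain a b c d : 0 < b -> 0 < d -> 0 < turn a b (X s1) (Y s1) ->
    0 < turn (X s2) (Y s2) c d -> 0 < turn a b c d.
  move=> b_0 d_0 h1 h2.
  apply: (turn_trans b_0 (Y0 s2) d_0 _ h2).
  by apply: (turn_trans b_0 (Y0 s1) (Y0 s2) h1); exact: turnXY.
(* Four distances below [1/8] bound the two terms by [1/4] each, while the sums themselves have norm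
   at least [1]. *)
have small : N1 v w + N1 (X s0 - X s2) (Y s0 - Y s2) <= 1 / 2.
  have h1 : N1 v w <= 1 / 4.
    have := norm_triangle n1 (y1 - (X t1)) (y2 - (Y t1)) ((X t1) - x1) ((Y t1) - x2).
    rewrite (norm_sub_sym n1 (X t1)).
    have -> : N1 (y1 - (X t1) + ((X t1) - x1)) (y2 - (Y t1) + ((Y t1) - x2)) = N1 v w.
      by congr N1; rewrite /v /w; ring.
    lra.
  have := norm_triangle n1 (X s0 - (X t1)) (Y s0 - (Y t1)) ((X t1) - X s2) ((Y t1) - Y s2).
  rewrite (norm_sub_sym n1 (X t1)).
  have -> : N1 (X s0 - (X t1) + ((X t1) - X s2)) (Y s0 - (Y t1) + ((Y t1) - Y s2)) =
    N1 (X s0 - X s2) (Y s0 - Y s2) by congr N1; ring.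
  lra.
have big s : N1 (X s - (X t1)) (Y s - (Y t1)) < 8^-1 -> 1 <= N1 (X s + x1) (Y s + x2).
  move=> h; have := norm_triangle n1 (X s + x1) (Y s + x2)
    ((X t1) - X s + ((X t1) - x1)) ((Y t1) - Y s + ((Y t1) - x2)).
  have := norm_triangle n1 ((X t1) - X s) ((Y t1) - Y s) ((X t1) - x1) ((Y t1) - x2).
  rewrite (norm_sub_sym n1 (X t1) (Y t1) (X s)) (norm_sub_sym n1 (X t1) (Y t1) x1).
  have -> : N1 (X s + x1 + ((X t1) - X s + ((X t1) - x1)))
      (Y s + x2 + ((Y t1) - Y s + ((Y t1) - x2))) = N1 (2 * (X t1)) (2 * (Y t1)).
    by congr N1; ring.
  by rewrite (norm_scale_ge0 n1)// NXY; lra.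
have := @parallel_chords _ _ n1 (X s0 + x1) (Y s0 + x2)
  (X s2 + x1) (Y s2 + x2) v w e1 e2.
rewrite !shift.
have -> : N1 (X s0 + x1 - (X s2 + x1)) (Y s0 + x2 - (Y s2 + x2)) =
  N1 (X s0 - X s2) (Y s0 - Y s2) by congr N1; ring.
have B0 := big s0 Ns0; have B2 := big s2 Ns2.
move=> h; exfalso.
have D1 := chain _ _ _ _ (b0 s0) (b0 s2) xm (turn_sum2 s2 _ _ xq2).
have D2 := chain _ _ _ _ (d0 s0) (b0 s2) ym (turn_sum2 s2 _ _ xq2).
have D3 := chain _ _ _ _ (b0 s0) (d0 s2) xm (turn_sum2 s2 _ _ yq2).
have D4 := chain _ _ _ _ (d0 s0) (d0 s2) ym (turn_sum2 s2 _ _ yq2).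
have bound c d c' d' : linear_on_cone N1 c d c' d' ->
    0 < turn c d c' d' -> 0 < d -> 0 < d' ->
    0 < turn c d (X s1) (Y s1) -> 0 < turn (X s2) (Y s2) c' d' -> False.
  move=> lin D d_0 d'_0 h1 h2.
  have T12 := turnXY s1 s2 s1s2.
  have := linear_on_coneD lin D (ltW h1)
    (ltW (turn_trans (Y0 s1) (Y0 s2) d'_0 T12 h2))
    (ltW (turn_trans d_0 (Y0 s1) (Y0 s2) h1 T12)) (ltW h2).
  by rewrite !NXY; lra.
have half a : 1 <= a -> N1 v w + N1 (X s0 - X s2) (Y s0 - Y s2) <= a.
  by move=> a1; apply: (le_trans small (le_trans half1 a1)).
have [lin|lin] := h (b0 s0) (b0 s2) (d0 s0) (d0 s2) V0 (half _ B0) (half _ B2)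
  D1 D2 D3 D4.
- exact: (bound _ _ _ _ lin D1 (b0 s0) (b0 s2) xm (turn_sum2 s2 _ _ xq2)).
- exact: (bound _ _ _ _ lin D4 (d0 s0) (d0 s2) ym (turn_sum2 s2 _ _ yq2)).
Qed.

Lemma corner_extension t0 t1 : t0 < t1 ->
  (forall t, t0 <= t -> t <= t1 -> fixed_dir N1 J t 1) ->
  (forall t, t0 <= t -> t < t1 ->
    N1 (t / N1 t 1 + t1 / N1 t1 1) ((N1 t 1)^-1 + (N1 t1 1)^-1) != 2) ->
  exists2 e, 0 < e & forall t, t1 <= t -> t <= t1 + e -> fixed_ray N1 J t.
Proof.
move=> t01 fixt corner.
pose X t := t / N1 t 1; pose Y t := (N1 t 1)^-1.
have XY t : X t = t * Y t by [].
have Y0 t : 0 < Y t by rewrite invr_gt0 norm_gt0.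
have NXY t : N1 (X t) (Y t) = 1 by exact: norm_normalized.
have JXY t : t0 <= t -> t <= t1 -> J (X t) (Y t) (X t) (Y t) /\
    J (- X t) (- Y t) (- X t) (- Y t).
  move=> h1 h2; have f := fixt t h1 h2.
  have e1 : X t = Y t * t by rewrite mulrC XY.
  have e2 : Y t = Y t * 1 by rewrite mulr1.
  split; first by rewrite e1 {2 4}e2; apply: f; rewrite -e1 -e2 NXY.
  rewrite e1 {2 4}e2 -!mulNr; apply: f.
  by rewrite !mulNr (normN n1) -e1 -e2 NXY.
have turnXY s t : s < t -> 0 < turn (X s) (Y s) (X t) (Y t).
  move=> st; have -> : turn (X s) (Y s) (X t) (Y t) = (t - s) * (Y s * Y t).
    by rewrite /turn !XY; ring.
  by rewrite mulr_gt0 ?subr_gt0// mulr_gt0.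
pose p1 := X t1; pose p2 := Y t1.
have c8 : 0 < 8^-1 :> R by rewrite invr_gt0.
have [r r0 hr] := near_origin_sphere t1 n1 (near_origin_norm n1 c8).
have [s0 [s01 s0t1 Ns0]] : exists s0,
    [/\ t0 <= s0, s0 < t1 & N1 (X s0 - p1) (Y s0 - p2) < 8^-1].
  exists (Num.max t0 (t1 - r / 2)); split.
  - by rewrite le_max lexx.
  - by rewrite gt_max t01; lra.
  - apply: hr; set m := Num.max _ _.
    have m1 : t1 - r / 2 <= m by rewrite /m le_max lexx orbT.
    have m2 : m < t1 by rewrite /m gt_max t01; lra.
    by rewrite ltr0_norm; lra.
pose q1 := X s0; pose q2 := Y s0.
(* The direction of [2 p + q] is strictly between those of [p + q] and [p], so sums of [q] with
   points close to [p] still lie before [s1]. *)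
pose s1 := (2 * p1 + q1) / (2 * p2 + q2).
have p20 : 0 < p2 := Y0 t1; have q20 : 0 < q2 := Y0 s0.
have den0 : 0 < 2 * p2 + q2 by lra.
have pE : p1 = t1 * p2 := XY t1; have qE : q1 = s0 * q2 := XY s0.
have s1E : s1 * (2 * p2 + q2) = 2 * p1 + q1 by rewrite divfK// gt_eqF.
have s0s1 : s0 < s1.
  rewrite ltr_pdivlMr// pE qE.
  have : 0 < (t1 - s0) * p2 by rewrite mulr_gt0// subr_gt0.
  lra.
have s1t1 : s1 < t1.
  rewrite ltr_pdivrMr// pE qE.
  have : 0 < (t1 - s0) * q2 by rewrite mulr_gt0// subr_gt0.
  lra.
have mid : N1 (X s1 + p1) (Y s1 + p2) < 2.
  rewrite lt_neqAle; apply/andP; split; first by apply: corner; lra.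
  by have := norm_triangle n1 (X s1) (Y s1) p1 p2; rewrite !NXY; lra.
have gap0 : 0 < 2 - N1 (X s1 + p1) (Y s1 + p2) by lra.
have [r' r'0 hr'] := near_origin_sphere t1 n1 (near_origin_and
  (near_origin_norm n1 c8) (near_origin_norm n1 gap0)).
have [s2 [s1s2 s2t1 Ns2 gap]] : exists s2,
    [/\ s1 < s2, s2 < t1, N1 (X s2 - p1) (Y s2 - p2) < 8^-1 &
        N1 (X s1 + X s2) (Y s1 + Y s2) < 2].
  pose m := Num.max ((s1 + t1) / 2) (t1 - r' / 2).
  have m0 : (s1 + t1) / 2 <= m by rewrite /m le_max lexx.
  have m1 : t1 - r' / 2 <= m by rewrite /m le_max lexx orbT.
  have m2 : m < t1 by rewrite /m gt_max; apply/andP; split; lra.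
  have [h1 h2] := hr' m ltac:(rewrite ltr0_norm; lra).
  exists m; split=> //; first by lra.
  have := norm_triangle n1 (X s1 + p1) (Y s1 + p2) (X m - p1) (Y m - p2).
  have -> : N1 (X s1 + p1 + (X m - p1)) (Y s1 + p2 + (Y m - p2)) =
    N1 (X s1 + X m) (Y s1 + Y m) by congr N1; ring.
  by rewrite /X /Y /p1 /p2 in h2 *; lra.
have turn_q s : s < t1 -> near_origin (fun x y =>
    0 < turn (X s) (Y s) (p1 + x) (p2 + y)).
  by move=> st; apply: near_origin_turn_gt0; exact: turnXY.
have turn_sum s a b : 0 < turn (X s + p1) (Y s + p2) a b ->
    near_origin (fun x y =>
      0 < turn (X s + (p1 + x)) (Y s + (p2 + y)) a b).
  move=> /near_origin_turn_gt0l[z z0 hz].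
  by exists z => // x y xz yz; rewrite !addrA; exact: hz.
have near_p2 : near_origin (fun x y : R => 0 < p2 + y).
  exists p2 => // x y _; rewrite ltr_norml; lra.
have sum_top s : s < t1 -> 0 < turn (X s + p1) (Y s + p2) p1 p2.
  move=> st; have := turnXY s t1 st.
  by rewrite -/p1 -/p2 /turn; lra.
have sum_mid : 0 < turn (q1 + p1) (q2 + p2) (X s1) (Y s1).
  have -> : turn (q1 + p1) (q2 + p2) (X s1) (Y s1) =
      Y s1 * (s1 * (q2 + p2) - (q1 + p1)).
    by rewrite /turn XY; ring.
  apply: mulr_gt0 => //.
  rewrite -(pmulr_rgt0 _ den0).
  have -> : (2 * p2 + q2) * (s1 * (q2 + p2) - (q1 + p1)) =
      (2 * p1 + q1) * (q2 + p2) - (2 * p2 + q2) * (q1 + p1).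
    by rewrite -s1E; ring.
  have := turnXY s0 t1 s0t1; rewrite -/p1 -/p2 -/q1 -/q2 /turn; lra.
have near := near_origin_and (near_origin_and (near_origin_and
  (turn_q s0 s0t1) (turn_q s2 s2t1)) (near_origin_and
  (turn_sum s0 p1 p2 (sum_top s0 s0t1)) (turn_sum s2 p1 p2 (sum_top s2 s2t1))))
  (near_origin_and (turn_sum s0 (X s1) (Y s1) sum_mid)
  (near_origin_and near_p2 (near_origin_norm n1 c8))).
(* The image is as far from [p] in [N2] as the point is in [N1], so a single ball of radius [z]
   places both in the required neighbourhood. *)
have [z z0 hz] := near_origin_ball n2 near.
have [e e0 he] := near_origin_sphere t1 n1
  (near_origin_and near (near_origin_norm n1 z0)).
exists (e / 2); first by rewrite divr_gt0.
move=> t t1t te; apply/(fixed_ray_point _ _ n1); rewrite -/(X t) -/(Y t).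
have [y1 [y2 j]] : exists y1 y2, J (X t) (Y t) y1 y2.
  by case: iso => _ ex _ _; apply: ex; exact: NXY.
have te' : `|t - t1| < e by rewrite ger0_norm; lra.
have [near_x xz] := he t te'.
have dist a b a' b' c d c' d' : J a b c d -> J a' b' c' d' ->
    N1 (a - a') (b - b') = N2 (c - c') (d - d').
  by case: iso => _ _ _; apply.
have [jp _] := JXY t1 (ltW t01) (lexx t1).
have near_y := hz (y1 - p1) (y2 - p2).
rewrite -(dist _ _ _ _ _ _ _ _ j jp) in near_y.
have {}near_y := near_y xz.
have back (c d : R) : c + (d - c) = d by ring.
move: near_x near_y; rewrite -/(X t) -/(Y t) -/(X t1) -/(Y t1).
rewrite -/p1 -/p2 !back -/q1 -/q2.
move=> [[[xq1 xq2] _] [xm [x20 xp]]].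
move=> [[[yq1 yq2] [ys1 ys2]] [ym [y20 yp]]].
have ray s : t0 <= s -> s <= t1 -> fixed_ray N1 J s.
  by move=> h1 h2; apply: fixed_dir_ray; exact: fixt.
have Jopp s : t0 <= s -> s <= t1 -> J (- X s) (- Y s) (- X s) (- Y s).
  by move=> h1 h2; have [] := JXY s h1 h2.
have [e1 e2] := corner_step XY Y0 NXY ray Jopp s01 s0s1 s1s2 s2t1 Ns0 Ns2 gap
  j x20 y20 xp yp yq1 yq2 xq2 xm ym ys1 ys2.
by rewrite {1}e1 e2 in j.
Qed.

End CornerExtension.

(** * Continuation along the whole sphere *)

Lemma planar_isom_reflect (R : realType) (N1 N2 : R -> R -> R) J :
  planar_isom N1 N2 J ->
  planar_isom (fun a b => N1 (- a) b) (fun a b => N2 (- a) b)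
    (fun a b c d => J (- a) b (- c) d).
Proof.
move=> [h1 h2 h3 h4]; split=> //.
- by move=> a b c d /h1.
- by move=> a b /h2[c [d h]]; exists (- c), d; rewrite opprK.
- by move=> c d /h3[a [b h]]; exists (- a), b; rewrite opprK.
- move=> a b c d a' b' c' d' h h'.
  by rewrite !opprD; exact: h4 h h'.
Qed.

Section Continuation.
Context {R : realType}.
Implicit Types (N : R -> R -> R) (J : R -> R -> R -> R -> Prop).
Implicit Types (a b s t v w : R).

Lemma fixed_dir_limit N1 N2 J a b v w (r : R) :
  planar_norm N1 -> planar_norm N2 -> planar_isom N1 N2 J -> 0 < r ->
  (forall s, 0 < s -> s < r -> fixed_dir N1 J (a + s * v) (b + s * w)) ->
  fixed_dir N1 J a b.
Proof.
move=> n1 n2 iso r0 fixs l Nl.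
have [y1 [y2 j]] : exists y1 y2, J (l * a) (l * b) y1 y2.
  by case: iso => _ ex _ _; exact: ex.
suff : N2 (y1 - l * a) (y2 - l * b) = 0.
  move=> /(norm_eq0 n2)[/eqP + /eqP]; rewrite !subr_eq0 => /eqP e1 /eqP e2.
  by rewrite e1 e2 in j.
set D := N2 _ _; apply/eqP; rewrite eq_le (norm_ge0 n2) andbT leNgt.
apply/negP => D0.
pose V1 := N1 (l * v) (l * w); pose V2 := N2 (l * v) (l * w).
have V10 : 0 <= V1 := norm_ge0 n1 _ _.
have V20 : 0 <= V2 := norm_ge0 n2 _ _.
(* Normalizing the displaced point moves it by [|1 - n| <= s * V1], in either norm. Adding the
   displacements [s * V1] and [s * V2] gives [D <= s * (3 * V1 + V2)]. *)
pose K := 3 * V1 + V2 + 1.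
have K0 : 0 < K by rewrite /K; lra.
have [s [s0 sr sD sV]] : exists s, [/\ 0 < s, s < r, s * K < D & s * K < 1].
  pose m := Num.min r (Num.min (D / K) (1 / K)).
  have m0 : 0 < m by rewrite !lt_min r0 !divr_gt0.
  exists (m / 2); split; first by rewrite divr_gt0.
  - have : m <= r by rewrite /m ge_min lexx.
    by lra.
  - have : m <= D / K by rewrite /m !ge_min lexx orbT.
    by rewrite ler_pdivlMr//; lra.
  - have : m <= 1 / K by rewrite /m !ge_min lexx !orbT.
    by rewrite ler_pdivlMr//; lra.
pose x1 := l * a + s * (l * v); pose x2 := l * b + s * (l * w).
pose n := N1 x1 x2.
have sV1 : s * V1 < 1.
  by apply: le_lt_trans sV; rewrite ler_pM2l// /K; lra.
have scale1 : N1 (s * (l * v)) (s * (l * w)) = s * V1.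
  by rewrite (norm_scale_ge0 n1)// ltW.
have scale2 : N2 (s * (l * v)) (s * (l * w)) = s * V2.
  by rewrite (norm_scale_ge0 n2)// ltW.
have n_le : n <= 1 + s * V1.
  by rewrite -Nl -scale1; exact: norm_triangle.
have n_ge : 1 <= n + s * V1.
  rewrite -Nl -scale1 -(normN n1 (s * _)).
  have -> : l * a = x1 + - (s * (l * v)) by rewrite /x1; ring.
  have -> : l * b = x2 + - (s * (l * w)) by rewrite /x2; ring.
  exact: norm_triangle.
have n0 : 0 < n by lra.
have nn : n != 0 by rewrite gt_eqF.
have i0 : 0 <= n^-1 by rewrite invr_ge0 ltW.
have e1 : l / n * (a + s * v) = n^-1 * x1 by rewrite /x1; ring.
have e2 : l / n * (b + s * w) = n^-1 * x2 by rewrite /x2; ring.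
have := fixs s s0 sr (l / n); rewrite e1 e2 (norm_scale_ge0 n1)// mulVf//.
move=> /(_ erefl) j'.
have N2x : N2 x1 x2 = n.
  case: iso => h _ _ _; have [_] := h _ _ _ _ j'.
  rewrite (norm_scale_ge0 n2)// => e.
  by rewrite -[LHS]mul1r -(divff nn) -mulrA e mulr1.
have split_diff N : planar_norm N -> N x1 x2 = n ->
    N (l * a - n^-1 * x1) (l * b - n^-1 * x2) <=
    N (s * (l * v)) (s * (l * w)) + `|1 - n|.
  move=> hN Nx.
  have -> : l * a - n^-1 * x1 = - (s * (l * v)) + (1 - n^-1) * x1.
    by rewrite /x1; ring.
  have -> : l * b - n^-1 * x2 = - (s * (l * w)) + (1 - n^-1) * x2.
    by rewrite /x2; ring.
  apply: le_trans (norm_triangle hN _ _ _ _) _.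
  rewrite (normN hN) lerD2l (norm_scale hN) Nx -{2}(gtr0_norm n0) -normrM.
  rewrite -(normrN (1 - n)) (_ : - (1 - n) = (1 - n^-1) * n)//.
  by field.
have n1e : `|1 - n| <= s * V1 by rewrite ler_norml; lra.
have h1 := split_diff _ n1 erefl; have h2 := split_diff _ n2 N2x.
rewrite scale1 in h1; rewrite scale2 in h2.
case: iso => _ _ _ dist; have h3 := dist _ _ _ _ _ _ _ _ j j'.
have h4 := norm_triangle n2 (y1 - n^-1 * x1) (y2 - n^-1 * x2)
  (n^-1 * x1 - l * a) (n^-1 * x2 - l * b).
rewrite (norm_sub_sym n2 (n^-1 * x1)) -h3 in h4.
have e3 : N2 (y1 - n^-1 * x1 + (n^-1 * x1 - l * a))
    (y2 - n^-1 * x2 + (n^-1 * x2 - l * b)) = D.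
  by rewrite /D; congr N2; ring.
by rewrite e3 in h4; rewrite /K in sD; lra.
Qed.

Lemma fixed_interval_extension N1 N2 J t0 t1 :
  planar_norm N1 -> planar_norm N2 -> planar_isom N1 N2 J -> t0 < t1 ->
  (forall t, t0 <= t -> t <= t1 -> fixed_dir N1 J t 1) ->
  exists2 e : R, 0 < e &
    forall t, t1 <= t -> t <= t1 + e -> fixed_dir N1 J t 1.
Proof.
move=> n1 n2 iso t01 fixt.
have [[s [t0s st1 mid]]|none] := pselect (exists s, [/\ t0 <= s, s < t1 &
    N1 (s / N1 s 1 + t1 / N1 t1 1) ((N1 s 1)^-1 + (N1 t1 1)^-1) = 2]).
  apply: (segment_extension n1 n2 iso st1 _ mid) => t st tt1.
  by apply: fixt => //; exact: le_trans st.
have corner t : t0 <= t -> t < t1 ->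
    N1 (t / N1 t 1 + t1 / N1 t1 1) ((N1 t 1)^-1 + (N1 t1 1)^-1) != 2.
  by move=> t0t tt1; apply/eqP => mid; apply: none; exists t.
have fixn t : t0 <= t -> t <= t1 ->
    fixed_dir N1 (fun a b c d => J (- a) (- b) (- c) (- d)) t 1.
  move=> t0t tt1 l Nl; rewrite -!mulNr; apply: fixt => //.
  by rewrite !mulNr (normN n1).
have [e e0 h] := corner_extension n1 n2 iso t01 fixt corner.
have [e' e'0 h'] :=
  corner_extension n1 n2 (planar_isom_neg n1 n2 iso) t01 fixn corner.
exists (Num.min e e'); first by rewrite lt_min e0.
move=> t t1t tm; have : Num.min e e' <= e by rewrite ge_min lexx.
have : Num.min e e' <= e' by rewrite ge_min lexx orbT.
move=> m1 m2; apply: fixed_ray_dir => //.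
  by apply: h => //; lra.
by apply: h' => //; lra.
Qed.

Lemma fixed_right N1 N2 J t0 t1 :
  planar_norm N1 -> planar_norm N2 -> planar_isom N1 N2 J -> t0 < t1 ->
  (forall t, t0 <= t -> t <= t1 -> fixed_dir N1 J t 1) ->
  forall t, t0 <= t -> fixed_dir N1 J t 1.
Proof.
move=> n1 n2 iso t01 fixt t t0t.
have [tt1|t1t] := leP t t1; first exact: fixt.
pose S := [set s | t1 <= s <= t /\
  forall r, t0 <= r -> r <= s -> fixed_dir N1 J r 1].
have St1 : S t1 by split=> //; rewrite lexx ltW.
have hS : has_sup S by split; [exists t1|exists t => s [/andP[]]].
pose T := sup S.
have t1T : t1 <= T by apply: ub_le_sup => //; case: hS.
have Tt : T <= t by apply: ge_sup; [exists t1|move=> s [/andP[]]].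
have below r : t0 <= r -> r < T -> fixed_dir N1 J r 1.
  move=> t0r rT; have e0 : 0 < T - r by rewrite subr_gt0.
  have [s [_ hs] rs] := sup_adherent e0 hS.
  by apply: hs => //; rewrite -/T in rs; lra.
have fixT : fixed_dir N1 J T 1.
  apply: (@fixed_dir_limit N1 N2 J T 1 (-1) 0 (T - t0)) => //; first by lra.
  move=> s s0 sT; rewrite mulr0 addr0; apply: below; lra.
have upto r : t0 <= r -> r <= T -> fixed_dir N1 J r 1.
  move=> t0r; rewrite le_eqVlt => /orP[/eqP->//|]; exact: below.
have t0T : t0 < T by lra.
have [e e0 ext] := fixed_interval_extension n1 n2 iso t0T upto.
move: Tt; rewrite le_eqVlt => /orP[/eqP <- //|Tt].
pose m := Num.min (T + e) t.
have mT : m <= T + e by rewrite /m ge_min lexx.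
have mt : m <= t by rewrite /m ge_min lexx orbT.
have Tm : T < m by rewrite /m lt_min; apply/andP; split; lra.
suff : m <= T by rewrite leNgt Tm.
apply: ub_le_sup; first by case: hS.
split; first by apply/andP; split; lra.
move=> r t0r rm; have [rT|Tr] := leP r T; first exact: upto.
by apply: ext; lra.
Qed.

Lemma fixed_all N1 N2 J t0 t1 :
  planar_norm N1 -> planar_norm N2 -> planar_isom N1 N2 J -> t0 < t1 ->
  (forall t, t0 <= t -> t <= t1 -> fixed_dir N1 J t 1) ->
  forall a b, N1 a b = 1 -> J a b a b.
Proof.
move=> n1 n2 iso t01 fixt.
have fixR := fixed_right n1 n2 iso t01 fixt.
have fixT t : fixed_dir N1 J t 1.
  have [t0t|tt0] := leP t0 t; first exact: fixR.
  have m01 : - t1 < - t0 by lra.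
  have fixm s : - t1 <= s -> s <= - t0 -> fixed_dir (fun a b => N1 (- a) b)
      (fun a b c d => J (- a) b (- c) d) s 1.
    move=> s1 s2 l; rewrite -mulrN => Nl.
    by apply: (fixt (- s) _ _ l) => //; lra.
  have := fixed_right (planar_norm_reflect n1) (planar_norm_reflect n2)
    (planar_isom_reflect iso) m01 fixm.
  move=> /(_ (- t) _) h l Nl; have := h ltac:(lra) l.
  by rewrite mulrN opprK; exact.
(* The only direction that is not a multiple of some [(t, 1)] is a limit of the directions
   [(1, s)]. *)
have fix10 : fixed_dir N1 J 1 0.
  apply: (@fixed_dir_limit N1 N2 J 1 0 0 1 1) => // s s0 _ l.
  rewrite mulr0 addr0 add0r mulr1.
  have := fixT s^-1 (l * s); rewrite -mulrA divff ?gt_eqF// !mulr1; exact.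
move=> a b Nab; have [b0|b0] := eqVneq b 0.
  have := fix10 a; rewrite mulr0 mulr1 -b0; exact.
have := fixT (a / b) b; rewrite mulr1 mulrCA divff// mulr1; exact.
Qed.

End Continuation.

(** * Antipodes of the fixed arc *)

Section Antipodes.
Context {R : realType}.
Implicit Types (N : R -> R -> R) (J : R -> R -> R -> R -> Prop).
Implicit Types (a b s t u v w y : R).

Definition fixed_top N1 N2 J : Prop :=
  [/\ planar_norm N1, planar_norm N2, planar_isom N1 N2 J &
      forall s, -1 <= s -> s <= 1 -> J s 1 s 1].

Lemma fixed_top_flat N1 N2 J : fixed_top N1 N2 J ->
  (forall s, -1 <= s -> s <= 1 -> N1 s 1 = 1) /\
  (forall s, -1 <= s -> s <= 1 -> N2 s 1 = 1).
Proof.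
move=> [_ _ [sph _ _ _] fix0].
by split=> s s1 s2; have [] := sph _ _ _ _ (fix0 s s1 s2).
Qed.

Lemma fixed_top_sym N1 N2 J : fixed_top N1 N2 J ->
  fixed_top N2 N1 (fun a b c d => J c d a b).
Proof. by move=> [n1 n2 iso fix0]; split=> //; exact: planar_isom_sym. Qed.

Lemma flat_const_height N y1 y2 : planar_norm N ->
  (forall s, -1 <= s -> s <= 1 -> N s 1 = 1) -> N y1 y2 = 1 ->
  (forall s, -1 <= s -> s <= 1 -> N (y1 + s) (y2 + 1) = 2) -> y2 = 1.
Proof.
move=> n f Ny h.
have := flat_ge n f y1 y2; have := flat_ge n f (- y1) (- y2).
rewrite (normN n) Ny => y2_1 y2_2.
have := @flat_const _ _ n f (y1 - 1) (y1 + 1) (y2 + 1) 2 ltac:(lra).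
have h' r : y1 - 1 <= r -> r <= y1 + 1 -> N r (y2 + 1) = 2.
  move=> r1 r2; have -> : r = y1 + (r - y1) by ring.
  by apply: h; lra.
by move=> /(_ h'); rewrite ger0_norm; lra.
Qed.

Lemma flat_add N a b : planar_norm N ->
  (forall s, -1 <= s -> s <= 1 -> N s 1 = 1) -> N a 1 = 1 -> N b 1 = 1 ->
  N (a + b) (1 + 1) = 2.
Proof.
move=> n f Na Nb; apply/eqP; rewrite eq_le (flat_ge n f) andbT.
by have := norm_triangle n a 1 b 1; rewrite Na Nb.
Qed.

(** The antipode is at distance [2] from every fixed face point, which forces the height of its
    image to be [-1]. Which point [r] occurs is still open. *)
Lemma fixed_top_opp N1 N2 J s : fixed_top N1 N2 J -> N1 s 1 = 1 ->
  exists2 r, N2 r 1 = 1 & J (- s) (-1) (- r) (-1).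
Proof.
move=> hJ Ns; have [f1 f2] := fixed_top_flat hJ.
have [n1 n2 iso fix0] := hJ.
have [y1 [y2 j]] : exists y1 y2, J (- s) (-1) y1 y2.
  by case: iso => _ ex _ _; apply: ex; rewrite (normN n1).
have [_ Ny] : N1 (- s) (-1) = 1 /\ N2 y1 y2 = 1.
  by case: iso => sph _ _ _; exact: sph j.
have : - y2 = 1.
  apply: (@flat_const_height N2 (- y1)) => //; first by rewrite (normN n2).
  move=> r r1 r2; case: iso => _ _ _ dist.
  have -> : N2 (- y1 + r) (- y2 + 1) = N2 (y1 - r) (y2 - 1).
    by rewrite -(normN n2); congr N2; ring.
  rewrite -(dist _ _ _ _ _ _ _ _ j (fix0 r r1 r2)) -(normN n1).
  have -> : N1 (- (- s - r)) (- (-1 - 1)) = N1 (s + r) (1 + 1).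
    by congr N1; ring.
  by apply: flat_add => //; exact: f1.
move=> y2E; have {}y2E : y2 = -1 by lra.
subst y2; exists (- y1); last by rewrite opprK.
by rewrite -(normN n2) opprK.
Qed.

Lemma fixed_top_hor N1 N2 J : fixed_top N1 N2 J -> N1 1 0 = N2 1 0.
Proof.
move=> [n1 n2 [_ _ _ dist] fix0].
have := dist _ _ _ _ _ _ _ _ (fix0 1 ltac:(lra) ltac:(lra))
  (fix0 (-1) ltac:(lra) ltac:(lra)).
rewrite subrr opprK (norm_hor n1 (1 + 1)) (norm_hor n2 (1 + 1)).
have two : `|1 + 1 : R| != 0 by rewrite normr_eq0 gt_eqF ?addr_gt0.
exact: mulfI two _ _.
Qed.

Lemma dist_ends_eq (x y a b : R) : a < b -> `|x - a| = `|y - a| ->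
  `|x - b| = `|y - b| -> x = y.
Proof.
move=> ab /eqP + /eqP; rewrite !eqr_norm2.
by move=> /orP[/eqP|/eqP] ? /orP[/eqP|/eqP] ?; lra.
Qed.

(** By [fixed_top_opp] for the inverse, points of the opposite face come from the opposite face.
    Their individual preimages are not known, but sums of two face points always have norm [2]. *)
Lemma fixed_top_extend N1 N2 J s : fixed_top N1 N2 J -> N1 s 1 = 1 ->
  J s 1 s 1.
Proof.
move=> hJ Ns; have [f1 f2] := fixed_top_flat hJ.
have [n1 n2 iso fix0] := hJ; have c0 := norm10_gt0 n1.
have [y1 [y2 j]] : exists y1 y2, J s 1 y1 y2.
  by case: iso => _ ex _ _; exact: ex.
have [_ Ny] : N1 s 1 = 1 /\ N2 y1 y2 = 1.
  by case: iso => sph _ _ _; exact: sph j.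
have y2E : y2 = 1.
  apply: (@flat_const_height N2 y1) => // r r1 r2.
  have [b Nb j'] := fixed_top_opp (fixed_top_sym hJ) (f2 r r1 r2).
  case: iso => _ _ _ dist; have := dist _ _ _ _ _ _ _ _ j j'.
  by rewrite !opprK => <-; exact: flat_add.
subst y2.
have e r : -1 <= r -> r <= 1 -> `|s - r| = `|y1 - r|.
  move=> r1 r2; case: iso => _ _ _ dist.
  have := dist _ _ _ _ _ _ _ _ j (fix0 r r1 r2).
  rewrite subrr (norm_hor n1 (s - r)) (norm_hor n2 (y1 - r)).
  by rewrite -(fixed_top_hor hJ); apply: mulIf; rewrite gt_eqF.
have sy : s = y1 by apply: (@dist_ends_eq _ _ (-1) 1); rewrite ?e//; lra.
by subst y1.
Qed.

(* The isometry could a priori reflect the opposite face.  In that case the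
   image of the point of the sphere on the ray of [(1, 0)] would be closer to
   [(b, 1)] than to [(a, 1)] and closer to [(- b, -1)] than to [(- a, -1)],
   where [a < b] are the ends of the face. *)
Lemma fixed_top_bottom N1 N2 J s : fixed_top N1 N2 J -> -1 <= s -> s <= 1 ->
  J (- s) (-1) (- s) (-1).
Proof.
move=> hJ s1 s2; have [f1 f2] := fixed_top_flat hJ.
have [n1 n2 iso fix0] := hJ; have c0 := norm10_gt0 n1.
have fr r : -1 <= r -> r <= 1 -> N1 (- r) 1 = 1.
  by move=> r1 r2; apply: f1; lra.
have [b [b1 Nb right]] := flat_face_end n1 f1.
have [a' [a'1 Na' left']] := flat_face_end (planar_norm_reflect n1) fr.
pose a := - a'.
have a1 : a <= -1 by rewrite /a; lra.
have Na : N1 a 1 = 1 by [].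
have left r : r < a -> 1 < N1 r 1.
  by move=> ra; rewrite -(opprK r); apply: left'; rewrite /a in ra; lra.
have top r : N1 r 1 = 1 -> a <= r /\ r <= b.
  move=> Nr; split; rewrite leNgt; apply/negP => h.
    by have := left _ h; rewrite Nr ltxx.
  by have := right _ h; rewrite Nr ltxx.
clearbody a.
have sph u w u' w' : J u w u' w' -> N1 u w = 1 /\ N2 u' w' = 1.
  by case: iso => h _ _ _; exact: h.
have dist u w u' w' v x v' x' : J u w u' w' -> J v x v' x' ->
    N1 (u - v) (w - x) = N2 (u' - v') (w' - x').
  by case: iso => _ _ _; apply.
have top2 r : N2 r 1 = 1 -> a <= r /\ r <= b.
  by move=> /(fixed_top_extend (fixed_top_sym hJ)) /sph[/top].
have [beta Nbeta jb] := fixed_top_opp hJ Nb.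
have [alpha Nalpha ja] := fixed_top_opp hJ Na.
have [sigma Nsigma js] := fixed_top_opp hJ (f1 s s1 s2).
have bottom r r' x x' : J (- r) (-1) (- x) (-1) -> J (- r') (-1) (- x') (-1) ->
    `|r - r'| = `|x - x'|.
  move=> j j'; have := dist _ _ _ _ _ _ _ _ j j'.
  rewrite subrr (norm_hor n1 (_ - _)) (norm_hor n2 (- x - _)).
  rewrite -(fixed_top_hor hJ) -!opprD !normrN.
  by apply: mulIf; rewrite gt_eqF.
have [aa ab] := top2 _ Nalpha; have [ba bb] := top2 _ Nbeta.
have := bottom _ _ _ _ jb ja; rewrite (@ger0_norm _ (b - a)); last by lra.
have [le_ab|lt_ba] := leP alpha beta.
  rewrite ger0_norm ?subr_ge0// => len.
  have [eb ea] : beta = b /\ alpha = a by split; lra.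
  subst beta; subst alpha.
  have e : s = sigma.
    by apply: (@dist_ends_eq _ _ a b);
      [lra|exact: bottom js ja|exact: bottom js jb].
  by subst sigma.
rewrite ltr0_norm ?subr_lt0// => len.
have [eb ea] : beta = a /\ alpha = b by split; lra.
subst beta; subst alpha; exfalso; clear js bottom ba bb aa ab lt_ba len.
pose u0 := (N1 1 0)^-1.
have u00 : 0 < u0 by rewrite invr_gt0.
have Nu0 : N1 u0 0 = 1.
  by rewrite (norm_hor n1 u0) gtr0_norm// mulVf// gt_eqF.
have [u [w j]] : exists u w, J u0 0 u w.
  by case: iso => _ ex _ _; exact: ex.
have [_ Nuw] := sph _ _ _ _ j; clearbody u0.
have w1 : -1 <= w /\ w <= 1.
  have := flat_ge n2 f2 u w; have := flat_ge n2 f2 (- u) (- w).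
  by rewrite (normN n2) Nuw => *; split; lra.
have ja2 := fixed_top_extend hJ Na; have jb2 := fixed_top_extend hJ Nb.
have N2a : N2 a 1 = 1 by have [] := sph _ _ _ _ ja2.
have lt1 : N2 (u - b) (w - 1) < N2 (u - a) (w - 1).
  rewrite -(dist _ _ _ _ _ _ _ _ j ja2) -(dist _ _ _ _ _ _ _ _ j jb2) sub0r.
  have out : 1 < N1 (u0 - a) (-1).
    by rewrite -(normN n1) opprB opprK; apply: left; lra.
  apply: (@norm_mono_lt _ _ n1 (- b)); [lra|lra|].
  by rewrite (normN n1) Nb.
have lt2 : N2 (u + b) (w + 1) < N2 (u + a) (w + 1).
  have := dist _ _ _ _ _ _ _ _ j ja; have := dist _ _ _ _ _ _ _ _ j jb.
  rewrite !opprK add0r => <- <-.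
  have out : 1 < N1 (u0 + b) 1 by apply: right; lra.
  apply: (@norm_mono_lt _ _ n1 a); [lra|lra|].
  by rewrite Na.
have scale r : 0 <= r -> N2 (r * a) r = r.
  by move=> r0; rewrite -[X in N2 _ X]mulr1 (norm_scale_ge0 n2)// N2a mulr1.
(* The line through the origin and [(a, 1)] separates the cases. To the right of its point at height
   [w + 1], where the norm attains its minimum, the norm is nondecreasing, against [lt2]; on the
   other side the same holds at height [1 - w], against [lt1]. *)
have [uw|wu] := leP (w * a) u.
  suff : N2 (u + a) (w + 1) <= N2 (u + b) (w + 1) by lra.
  apply: (@norm_mono _ _ n2 ((w + 1) * a)); [lra|lra|].
  by rewrite scale ?(flat_ge n2 f2)//; lra.
suff : N2 (a - u) (1 - w) <= N2 (b - u) (1 - w).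
  by rewrite (norm_sub_sym n2 a) (norm_sub_sym n2 b); lra.
apply: (@norm_mono _ _ n2 ((1 - w) * a)); [lra|lra|].
by rewrite scale ?(flat_ge n2 f2)//; lra.
Qed.

End Antipodes.

Lemma antipodal_segment (R : realType) (N1 N2 : R -> R -> R) J (t0 t1 : R) :
  planar_norm N1 -> planar_norm N2 -> planar_isom N1 N2 J -> t0 < t1 ->
  N1 (t0 / N1 t0 1 + t1 / N1 t1 1) ((N1 t0 1)^-1 + (N1 t1 1)^-1) = 2 ->
  (forall t, t0 <= t -> t <= t1 -> fixed_ray N1 J t) ->
  forall t, t0 <= t -> t <= t1 -> fixed_dir N1 J t 1.
Proof.
move=> n1 n2 iso t01 mid fixt t t0t tt1.
have k00 := norm_gt0 n1 t0 (@ltr01 R).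
have k10 := norm_gt0 n1 t1 (@ltr01 R).
pose p1 := t1 / N1 t1 1; pose p2 := (N1 t1 1)^-1.
pose q1 := t0 / N1 t0 1; pose q2 := (N1 t0 1)^-1.
pose x1 := (p1 - q1) / 2; pose x2 := (p2 - q2) / 2.
pose y1 := (p1 + q1) / 2; pose y2 := (p2 + q2) / 2.
have det : x1 * y2 - x2 * y1 != 0.
  have -> : x1 * y2 - x2 * y1 = (t1 - t0) / (2 * N1 t1 1 * N1 t0 1).
    by rewrite /x1 /x2 /y1 /y2 /p1 /p2 /q1 /q2; field; rewrite !gt_eqF.
  by rewrite gt_eqF// divr_gt0 ?mulr_gt0//; lra.
have hJ : fixed_top
    (fun a b => N1 (a * x1 + b * y1) (a * x2 + b * y2))
    (fun a b => N2 (a * x1 + b * y1) (a * x2 + b * y2))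
    (fun a b c d => J (a * x1 + b * y1) (a * x2 + b * y2)
                      (c * x1 + d * y1) (c * x2 + d * y2)).
  split; [exact: planar_norm_basis|exact: planar_norm_basis| |].
    exact: planar_isom_basis.
  move=> s s1 s2.
  have a0 : 0 <= (1 - s) / 2 by rewrite divr_ge0//; lra.
  have b0 : 0 <= (1 + s) / 2 by rewrite divr_ge0//; lra.
  have ab : (1 - s) / 2 + (1 + s) / 2 = 1 by field.
  have [r [t0r rt1 e1 e2]] := segment_point n1 t01 mid a0 b0 ab.
  have -> : s * x1 + 1 * y1 = r / N1 r 1.
    by rewrite -e1 /x1 /y1 -/p1 -/q1; field.
  have -> : s * x2 + 1 * y2 = (N1 r 1)^-1.
    by rewrite -e2 /x2 /y2 -/p2 -/q2; field.
  exact/(fixed_ray_point J r n1)/fixt.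
apply: fixed_ray_dir => //; first exact: fixt.
apply/(fixed_ray_point _ _ n1).
have [k [l [k0 l0 kl e1 e2]]] := point_segment n1 t01 mid t0t tt1.
have := fixed_top_bottom (s := l - k) hJ ltac:(lra) ltac:(lra).
have -> : - (l - k) * x1 + -1 * y1 = - (t / N1 t 1).
  rewrite -e1 /x1 /y1 -/p1 -/q1.
  have -> : l = 1 - k by lra.
  by field.
have -> : - (l - k) * x2 + -1 * y2 = - (N1 t 1)^-1.
  rewrite -e2 /x2 /y2 -/p2 -/q2.
  have -> : l = 1 - k by lra.
  by field.
by [].
Qed.

Lemma antipodal_start (R : realType) (N1 N2 : R -> R -> R) J (t0 t1 : R) :
  planar_norm N1 -> planar_norm N2 -> planar_isom N1 N2 J -> t0 < t1 ->
  (forall t, t0 <= t -> t <= t1 -> fixed_ray N1 J t) ->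
  exists s0 s1, s0 < s1 /\
    forall t, s0 <= t -> t <= s1 -> fixed_dir N1 J t 1.
Proof.
move=> n1 n2 iso t01 fixt.
pose X t := t / N1 t 1; pose Y t := (N1 t 1)^-1.
have [[s0 [s1 [t0s0 s01 s1t1 mid]]]|none] := pselect (exists s0 s1,
    [/\ t0 <= s0, s0 < s1, s1 <= t1 & N1 (X s0 + X s1) (Y s0 + Y s1) = 2]).
  exists s0, s1; split=> //.
  apply: (antipodal_segment n1 n2 iso s01 mid) => t s0t ts1.
  by apply: fixt; lra.
(* The middle third keeps [t] strictly inside the arc, so that the beginning of the segment from
   [X t] to [z] lies over the arc whichever way it points. *)
exists ((2 * t0 + t1) / 3), ((t0 + 2 * t1) / 3); split; first by lra.
move=> t t0t tt1; have [{}t0t {}tt1] : t0 < t /\ t < t1 by split; lra.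
have fixn : fixed_ray N1 J t by apply: fixt; lra.
apply: fixed_ray_dir => //; apply/(fixed_ray_point _ _ n1).
have XY s : X s = s * Y s by [].
have Y0 s : 0 < Y s by rewrite invr_gt0 norm_gt0.
have NXY s : N1 (X s) (Y s) = 1 by exact: norm_normalized.
have turnXY r s : r < s -> 0 < turn (X r) (Y r) (X s) (Y s).
  move=> rs; have -> : turn (X r) (Y r) (X s) (Y s) = (s - r) * (Y r * Y s).
    by rewrite /turn !XY; ring.
  by rewrite mulr_gt0 ?subr_gt0// mulr_gt0.
rewrite -/(X t) -/(Y t).
have [y1 [y2 j]] : exists y1 y2, J (- X t) (- Y t) y1 y2.
  by case: iso => _ ex _ _; apply: ex; rewrite (normN n1).
have jt : J (X t) (Y t) (X t) (Y t).
  exact/(fixed_ray_point _ _ n1).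
pose z1 := - y1; pose z2 := - y2.
have N2z : N2 z1 z2 = 1.
  by rewrite (normN n2); case: iso => sph _ _ _; have [] := sph _ _ _ _ j.
have N2t : N2 (X t) (Y t) = 1.
  by case: iso => sph _ _ _; have [] := sph _ _ _ _ jt.
have N2sum : N2 (X t + z1) (Y t + z2) = 2.
  case: iso => _ _ _ dist; rewrite -(dist _ _ _ _ _ _ _ _ jt j) !opprK.
  have -> : N1 (X t + X t) (Y t + Y t) = N1 (2 * X t) (2 * Y t).
    by congr N1; ring.
  by rewrite (norm_scale_ge0 n1)// NXY mulr1.
have lin := @norm_linear_on _ _ n2 (X t) (Y t) z1 z2 1 1 ltr01 ltr01.
rewrite !mul1r N2z N2t in lin; have {}lin := lin N2sum.
have [/andP[/eqP e1 /eqP e2]|ne] := boolP ((z1 == X t) && (z2 == Y t)).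
  by rewrite -[in X in J _ _ X _]e1 -[in X in J _ _ _ X]e2 /z1 /z2 !opprK.
exfalso; apply: none.
have near_Y : near_origin (fun x y : R => 0 < Y t + y).
  by exists (Y t) => // x y _; rewrite ltr_norml; lra.
have [r r0 hr] := near_origin_and (near_origin_and
  (near_origin_turn_gt0 (turnXY _ _ t0t))
  (near_origin_turn_gt0l (turnXY _ _ tt1))) near_Y.
pose d1 := z1 - X t; pose d2 := z2 - Y t.
have d10 := normr_ge0 d1; have d20 := normr_ge0 d2.
(* Makes [e = r / S] small enough for [e < 1] and for both displacements to be less than [r]. *)
pose S := r + `|d1| + `|d2| + 1.
have S0 : 0 < S by rewrite /S; lra.
pose e := r / S.
have e0 : 0 < e by rewrite divr_gt0.
have eS : e * S = r by rewrite divfK// gt_eqF.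
have e1 : e < 1 by rewrite ltr_pdivrMr// /S; lra.
have ed1 : 0 <= e * `|d1| by rewrite mulr_ge0// ltW.
have ed2 : 0 <= e * `|d2| by rewrite mulr_ge0// ltW.
have er : 0 < e * r by rewrite mulr_gt0.
have small1 : `|e * d1| < r.
  by rewrite normrM (gtr0_norm e0); rewrite /S in eS; lra.
have small2 : `|e * d2| < r.
  by rewrite normrM (gtr0_norm e0); rewrite /S in eS; lra.
have := hr _ _ small1 small2.
set a := X t + e * d1; set b := Y t + e * d2 => -[[h0 h1] b0].
pose s := a / b.
have sb : a = s * b by rewrite divfK// gt_eqF.
have aE : a = (1 - e) * X t + e * z1 by rewrite /a /d1; ring.
have bE : b = (1 - e) * Y t + e * z2 by rewrite /b /d2; ring.
have N2ab : N2 a b = 1.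
  by rewrite aE bE lin; lra.
have t0s : t0 <= s.
  apply/ltW; move: h0; rewrite turn_dir//.
  by rewrite /X /Y invrK divfK// gt_eqF// norm_gt0.
have st1 : s <= t1.
  apply/ltW; move: h1; rewrite turn_dir//.
  by rewrite /X /Y invrK divfK// gt_eqF// norm_gt0.
have N1ab : N1 a b = 1.
  by rewrite (fixed_ray_norm n1 n2 iso b0 sb) //; exact: fixt.
have bs : b = Y s.
  have : b * N1 s 1 = 1.
    by rewrite -(norm_scale_ge0 n1 _ _ (ltW b0)) mulr1 mulrC -sb.
  have kn : N1 s 1 != 0 by rewrite gt_eqF// norm_gt0.
  by move=> h; apply: (mulIf kn); rewrite h mulVf.
have as_ : a = X s by rewrite sb bs XY.
(* Linearity of [N2] on the cone of [X t] and [z] passes to [N1], since the sum also lies over the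
   fixed arc. *)
have mid : N1 (X t + X s) (Y t + Y s) = 2.
  rewrite -as_ -bs.
  have c0 : 0 < Y t + b by rewrite addr_gt0.
  pose m := (X t + a) / (Y t + b).
  have mc : X t + a = m * (Y t + b) by rewrite divfK// gt_eqF.
  have t0m : t0 <= m.
    rewrite ler_pdivlMr// sb XY.
    have : 0 <= (t - t0) * Y t by rewrite mulr_ge0 ?ltW// subr_gt0.
    have : 0 <= (s - t0) * b by rewrite mulr_ge0 ?subr_ge0// ltW.
    lra.
  have mt1 : m <= t1.
    rewrite ler_pdivrMr// sb XY.
    have : 0 <= (t1 - t) * Y t by rewrite mulr_ge0 ?ltW// subr_gt0.
    have : 0 <= (t1 - s) * b by rewrite mulr_ge0 ?subr_ge0// ltW.
    lra.
  rewrite (fixed_ray_norm n1 n2 iso c0 mc); last exact: fixt.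
  have -> : X t + a = (2 - e) * X t + e * z1 by rewrite aE; ring.
  have -> : Y t + b = (2 - e) * Y t + e * z2 by rewrite bE; ring.
  by rewrite lin; lra.
have [ts|st|ts] := ltgtP t s.
- by exists t, s; split=> //; lra.
- by exists s, t; split=> //; [lra|rewrite (addrC (X s)) (addrC (Y s))].
exfalso; move: ne.
have ed1' : e * d1 = 0 by rewrite -ts in as_; rewrite /a in as_; lra.
have ed2' : e * d2 = 0 by rewrite -ts in bs; rewrite /b in bs; lra.
move/eqP: ed1'; rewrite mulf_eq0 (gt_eqF e0) /d1 subr_eq0 => /eqP ->.
move/eqP: ed2'; rewrite mulf_eq0 (gt_eqF e0) /d2 subr_eq0 => /eqP ->.
by rewrite !eqxx.
Qed.

(** * Coordinates and the reduction to the plane *)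

Lemma vect_plane_coords (K : fieldType) (V : vectType K) (e f : V) :
  \dim {: V} = 2 -> (forall a b, a *: e + b *: f = 0 -> a = 0 /\ b = 0) ->
  forall v, exists a b, v = a *: e + b *: f.
Proof.
move=> dimV indep v.
have f0 : f != 0.
  apply/eqP => f0; have := indep 0 1; rewrite f0 scale0r scaler0 addr0.
  by move=> /(_ erefl)[_ /eqP]; rewrite oner_eq0.
have free_ef : free [:: e; f].
  rewrite free_cons span_seq1 seq1_free f0 andbT.
  apply/negP => /vlineP[k ek]; have := indep 1 (- k).
  rewrite ek scale1r scaleNr subrr => /(_ erefl)[/eqP].
  by rewrite oner_eq0.
have : basis_of {: V} [:: e; f] by rewrite basisEfree free_ef subvf dimV.
move=> /span_basis span_ef; have := memvf v.
rewrite -span_ef span_cons span_seq1.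
move=> /memv_addP[_ /vlineP[a ->] [_ /vlineP[b ->] ->]].
by exists a, b.
Qed.

Lemma vect_plane_complement (K : fieldType) (V : vectType K) (f : V) :
  \dim {: V} = 2 -> f != 0 ->
  exists e : V, forall a b, a *: e + b *: f = 0 -> a = 0 /\ b = 0.
Proof.
move=> dimV f0.
have : ~~ ({: V} <= <[f]>)%VS.
  by apply/negP => /dimvS; rewrite dimV dim_vline f0.
move=> /subvPn[e _ ef]; exists e => a b ab0.
have [a0|a0] := eqVneq a 0.
  split=> //; move/eqP: ab0; rewrite a0 scale0r add0r scaler_eq0 (negbTE f0).
  by rewrite orbF => /eqP.
exfalso; move/negP: ef; apply; apply/vlineP; exists (- (a^-1 * b)).
apply: (scalerI a0); rewrite scalerA mulrN mulVKf// scaleNr.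
by apply/eqP; rewrite -addr_eq0 ab0.
Qed.

Lemma planar_norm_coords (R : realType) (V : normedModType R) (e f : V) :
  (forall a b : R, a *: e + b *: f = 0 -> a = 0 /\ b = 0) ->
  planar_norm (fun a b => `|a *: e + b *: f|).
Proof.
move=> indep; split.
- move=> a b c d; rewrite !scalerDl addrACA; exact: ler_normD.
- by move=> k a b; rewrite -!scalerA -scalerDr normrZ.
- by move=> a b /normr0_eq0/indep.
Qed.

Theorem theorem3p7 (R : realType) (X Y : normedVectType R)
    (dimX : (\dim {: X} = 2)%N) (dimY : (\dim {: Y} = 2)%N)
    (tau : X -> Y)
    (tau_iso : onto_isometry (unit_sphere X) (unit_sphere Y) tau)
    (tau_lin : exists U : set X,
        [/\ U !=set0, relatively_open (unit_sphere X) U & linear_on U tau]) :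
  linear_on (unit_sphere X) tau.
Proof.
have [tauS taud taus] := tau_iso.
have [U [[x0 Ux0] [US oU] [T TU]]] := tau_lin; exists T.
have Sx0 : `|x0| = 1 by exact: US.
have x0n : x0 != 0 by rewrite -normr_eq0 Sx0 oner_eq0.
have [f indep] := vect_plane_complement dimX x0n.
have n1 := planar_norm_coords indep.
pose N1 (a b : R) := `|a *: f + b *: x0|.
have N01 : N1 0 1 = 1 by rewrite /N1 scale0r add0r scale1r.
have [e /andP[e0 e1] he] : exists2 e : R, 0 < e <= 1 &
    forall x, `|x| = 1 -> `|x - x0| < e -> U x.
  have /open_subspaceP[V oV VU] := oU.
  have Vx0 : V x0 by have [] : (V `&` unit_sphere X) x0 by rewrite VU.
  have /nbhs_ballP[e /= e0 he] : nbhs x0 V by apply: open_nbhs_nbhs.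
  (* The cap at [1] later rules out that a point of [U] near [x0] is sent to [- T x0], which is at
     distance [2] from [T x0]. *)
  exists (Num.min e 1).
    by rewrite lt_min e0 ltr01 ge_min lexx orbT.
  move=> x Sx; rewrite lt_min => /andP[xe _].
  have [] // : (U `&` unit_sphere X) x.
  by rewrite -VU; split=> //; apply: he; rewrite -ball_normE /= distrC.
have [r r0 hr] := near_origin_sphere 0 n1 (near_origin_norm n1 e0).
pose A t := t / N1 t 1; pose B t := (N1 t 1)^-1.
have NAB t : `|A t *: f + B t *: x0| = 1 := norm_normalized t n1.
have close t : `|t| < r -> `|A t *: f + B t *: x0 - x0| < e.
  move=> tr; have := hr t; rewrite subr0 -/(N1 t 1) -/(N1 0 1) => /(_ tr).
  by rewrite N01 mul0r subr0 invr1 scalerBl scale1r addrA.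
have UAB t : `|t| < r -> U (A t *: f + B t *: x0).
  by move=> tr; apply: he (close t tr).
have Tx0 : `|T x0| = 1 by rewrite -TU//; exact: tauS.
(* [T] is injective: if [T f] were a multiple of [T x0], points near [x0] would have images [T x0]
   or [- T x0]. The distance to [x0] leaves only [T x0], so [tau] would not be injective. *)
have indepT a b : a *: T f + b *: T x0 = 0 -> a = 0 /\ b = 0.
  move=> ab0; have [a0|a0] := eqVneq a 0.
    split=> //; move/eqP: ab0; rewrite a0 scale0r add0r scaler_eq0.
    by rewrite -(normr_eq0 (T x0)) Tx0 oner_eq0 orbF => /eqP.
  exfalso; pose k := - (a^-1 * b).
  have Tf : T f = k *: T x0.
    apply: (scalerI a0); rewrite scalerA /k mulrN mulVKf// scaleNr.
    by apply/eqP; rewrite -addr_eq0 ab0.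
  pose t := r / 2.
  have t0 : 0 < t by rewrite divr_gt0.
  have tr : `|t| < r by rewrite gtr0_norm// /t; lra.
  have TAB : T (A t *: f + B t *: x0) = (A t * k + B t) *: T x0.
    by rewrite linearD !linearZ /= Tf scalerA -scalerDl.
  have Nk : `|A t * k + B t| = 1.
    rewrite -(NAB t) -[LHS]mulr1 -Tx0 -normrZ -TAB -TU; last exact: UAB.
    by rewrite NAB; apply: tauS; exact: NAB.
  have := close t tr; rewrite -(taud _ _ (NAB t) Sx0).
  rewrite (TU _ (UAB t tr)) TAB (TU _ Ux0) -[X in _ - X]scale1r -scalerBl.
  rewrite normrZ Tx0 mulr1 => lt1.
  have k1 : A t * k + B t = 1.
    move/eqP: Nk; rewrite -[X in _ == X]normr1 eqr_norm2 => /orP[/eqP//|/eqP kN].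
    by move: lt1; rewrite kN ltr0_norm; lra.
  have : `|A t *: f + B t *: x0 - x0| = 0.
    rewrite -(taud _ _ (NAB t) Sx0).
    by rewrite (TU _ (UAB t tr)) TAB (TU _ Ux0) k1 scale1r subrr normr0.
  rewrite -addrA -[X in _ - X]scale1r -scalerBl => /normr0_eq0/indep[+ _].
  move/eqP; rewrite mulf_eq0 invr_eq0 (gt_eqF t0) /= gt_eqF//.
  exact: (norm_gt0 n1).
have n2 := planar_norm_coords indepT.
(* Target coordinates refer to the basis [T f], [T x0], so [J a b a b] says that [tau] and [T] agree
   at this point. *)
pose J (a b c d : R) := `|a *: f + b *: x0| = 1 /\
  tau (a *: f + b *: x0) = c *: T f + d *: T x0.
have iso : planar_isom N1 (fun a b => `|a *: T f + b *: T x0|) J.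
  split.
  - by move=> a b c d [Nab <-]; split=> //; exact: tauS.
  - move=> a b Nab.
    have [c [d cd]] := vect_plane_coords dimY indepT (tau (a *: f + b *: x0)).
    by exists c, d.
  - move=> c d Ncd; have [x Sx xcd] := taus _ Ncd.
    have [a [b xab]] := vect_plane_coords dimX indep x.
    by exists a, b; rewrite /J -xab.
  - move=> a b c d a' b' c' d' [Nab tab] [Nab' tab'].
    have := taud _ _ Nab Nab'; rewrite tab tab' /N1.
    have diff (V : lmodType R) (v w : V) (p q p' q' : R) :
        (p - p') *: v + (q - q') *: w = p *: v + q *: w - (p' *: v + q' *: w).
      by rewrite !scalerBl opprD addrACA.
    by rewrite !diff.
have r20 : - (r / 2) < r / 2 by lra.
have rays t : - (r / 2) <= t -> t <= r / 2 -> fixed_ray N1 J t.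
  move=> t1 t2; apply/(fixed_ray_point J t n1).
  rewrite -/(N1 t 1) -/(A t) -/(B t); split; first exact: NAB.
  rewrite TU; last by apply: UAB; rewrite ltr_norml; lra.
  by rewrite linearD !linearZ.
have [s0 [s1 [s01 fixs]]] := antipodal_start n1 n2 iso r20 rays.
move=> x Sx; have [a [b xab]] := vect_plane_coords dimX indep x.
have Nab : N1 a b = 1 by rewrite /N1 -xab.
have [_] := fixed_all n1 n2 iso s01 fixs Nab.
by rewrite -xab => ->; rewrite xab linearD !linearZ.
Qed.
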